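(* For $y_0>0$ let $A_{y_0}$ be the $\mathrm{Spin}(7)$-instanton on the trivial $\mathbb{C}^2$-bundle over $E$ and let $A_{\lim}$ be the $\mathrm{Spin}(7)$-instanton on $\pi^*E\to E$ defined in the context, and consider a sequence $\{A_{y_0}\}$ with $y_0\nearrow+\infty$. Then: (a) Given any $\kappa>0$, there is a null sequence $\lambda=\lambda(y_0,\kappa)>0$ (i.e. $\lambda\to0$ as $y_0\to+\infty$) such that for all $z\in Z$, $(s_{z,\lambda})^*A_{y_0}$ converges uniformly, with all derivatives, to $A^{asd}_\kappa$ on the unit ball $B_1\subset N_zZ\cong\mathbb{R}^4$. (b) The connections $A_{y_0}$ converge uniformly, with all derivatives, to $A_{\lim}$ on all compact subsets of $E\setminus Z$.
   Context: Geometry. $(Z,g_Z)$ is a compact oriented spin Einstein $4$-orbifold with scalar curvature $s>0$ and anti-self-dual Weyl curvature; smoothness is understood in the orbifold sense at singular points. $X\to Z$ is the principal $\mathrm{SU}(2)$-(orbi)bundle lifting the $\mathrm{SO}(3)$-frame bundle of $\Lambda^2_+Z$, and $E=X\times_{\mathrm{SU}(2)}\mathbb{C}^2$ is the positive spinor bundle, with projection $\pi:E\to Z$; $Z\subset E$ is the zero section. Fixing a unit vector $e\in\mathbb{C}^2$, the map $(r,p)\mapsto[p,re]$ identifies $(0,\infty)_r\times X\cong E\setminus Z$. Let $T_1,T_2,T_3$ be the basis of $\mathfrak{su}(2)$ with $[T_i,T_j]=2\epsilon_{ijk}T_k$, and let $\eta=\sum_i\eta_i\otimes T_i\in\Omega^1(X,\mathfrak{su}(2))$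 be the connection on $X$ induced by the Levi-Civita connection of $g_Z$. The horizontal $2$-forms $\omega_i$ are defined by $F_\eta=d\eta+\frac12[\eta\wedge\eta]=-\frac{s}{24}\sum_i\omega_i\otimes T_i$, i.e. $d\eta_i=-\frac{s}{24}\omega_i-2\eta_j\wedge\eta_k$ for $(i,j,k)$ cyclic; they form an orthogonal basis of the self-dual $2$-forms on $\ker\eta$ with $|\omega_i|=\sqrt2$ with respect to $\pi^*g_Z$. Fix $\nu_0>0$ and let $t(r),\nu(r)$, $r\ge0$, solve $\frac{d}{dr}\nu^2=6t$, $\frac{dt}{dr}=1-\frac{2t^2}{\nu^2}$ with $t(0)=0$, $\nu(0)=\nu_0$ (so $\nu^4(\nu^2-5t^2)^3=\nu_0^{10}$). Set $\varphi=t^3\eta_{123}-t\nu^2\frac{s}{48}\sum_i\eta_i\wedge\omega_i$, $\ \psi=\frac{\nu^4}{6}(\frac{s}{48})^2\sum_i\omega_i\wedge\omega_i-\nu^2t^2\frac{s}{48}(\eta_{12}\wedge\omega_3+\eta_{23}\wedge\omega_1+\eta_{31}\wedge\omega_2)$, $\ \Theta=dr\wedge\varphi+\psi$. Then $\Theta$ is closed and extends smoothly over the zero section $Z=\{r=0\}$ to a torsion-free $\mathrm{Spin}(7)$-structure on $E$ with metric $g_\Theta=dr^2+t^2\sum_i\eta_i\otimes\eta_i+\frac{s\nu^2}{48}\pi^*g_Z$ and orientation $\Theta\wedge\Theta$. Gauge theory. A connection $A$ is a $\mathrm{Spin}(7)$-instanton if $*F_A=-F_A\wedge\Theta$. Over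 $E\setminus Z$ the bundle $\pi^*E$ is tautologically trivialized (at $(r,p)$ the frame $p$ identifies $E_{\pi(p)}\cong\mathbb{C}^2$), so connections on it are $\mathfrak{su}(2)$-valued $1$-forms. The instantons are, on $E\setminus Z$, $$A_{y_0}=\frac{y_0\,t^2(r)}{1+2y_0\int_0^rt(u)\,du}\sum_{i=1}^3\eta_i\otimes T_i,\qquad A_{\lim}=\frac{t^2(r)}{2\int_0^rt(u)\,du}\sum_{i=1}^3\eta_i\otimes T_i,$$ where $A_{y_0}$ extends smoothly over $Z$ as a connection on $E\times\mathbb{C}^2$ and $A_{\lim}$ extends smoothly over $Z$ as a connection on $\pi^*E\to E$. Bubble. For $\kappa>0$, in polar coordinates on $\mathbb{R}^4\setminus\{0\}=\mathbb{R}^+_r\times S^3$, $A^{asd}_\kappa=\frac{\kappa r^2}{1+\kappa r^2}\sum_iT_i\otimes\eta_i$, with $\eta_i$ here the standard left-invariant coframe of $S^3=\mathrm{SU}(2)$ ($d\eta_i=-2\eta_j\wedge\eta_k$); this is the basic charge-$1$ anti-self-dual instanton with scale $\kappa$. For $z\in Z$, $\lambda>0$, $s_{z,\lambda}:B_1\subset N_zZ\to E$ is $s_{z,\lambda}(v)=\exp_z(\lambda v)$, where $N_zZ=E_z\cong\mathbb{R}^4$ (isometrically, via a choice of $p\in X_z$, under which the $\eta_i$ restrict to the left-invariant coframe) is the normal space and $\exp$ is the Riemannian exponential map of $g_\Theta$. *)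

(* Defs.v *)
From HB Require Import structures.
From mathcomp Require Import all_boot all_order all_algebra all_fingroup.
From mathcomp Require Import all_classical all_reals all_analysis.

Set Implicit Arguments.
Unset Strict Implicit.
Unset Printing Implicit Defensive.

Import Order.TTheory GRing.Theory Num.Theory.
Import numFieldNormedType.Exports.

Local Open Scope classical_set_scope.
Local Open Scope ring_scope.

(** * Smooth maps and C^oo convergence *)

Section Smooth.
Context {R : realType} {V W : normedModType R}.

Fixpoint iter_deriv (vs : seq V) (f : V -> W) : V -> W :=
  if vs is v :: vs' then (fun x => 'D_v (iter_deriv vs' f) x) else f.

(* For U open this is C^oo on U. *)
Definition smooth_on (U : set V) (f : V -> W) : Prop :=
  forall (vs : seq V) (x : V), U x -> differentiable (iter_deriv vs f) x.

(* The f_n are eventually smooth on the open set U, f is smooth on U, and on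
   K `<=` U every iterated derivative of f_n converges uniformly. *)
Definition cvg_smooth (U K : set V) (f_ : nat -> V -> W) (f : V -> W) : Prop :=
  [/\ \forall n \near \oo, smooth_on U (f_ n),
      smooth_on U f
    & forall (vs : seq V) (e : R), 0 < e ->
        \forall n \near \oo, forall x, K x ->
          `|iter_deriv vs (f_ n) x - iter_deriv vs f x| < e].

End Smooth.

(** * Quaternions *)

(* C^2 is identified with the quaternions H = 'rV_4 (coordinates 1, i, j, k)
   as a left module over SU(2) = {|h| = 1}, by sending h e to h; thus the
   fixed unit vector e is the quaternion 1. su(2) = Im H is 'rV_3, with T_1,
   T_2, T_3 = i, j, k, so that [T_i, T_j] = 2 eps_ijk T_k. *)
Section Quaternions.
Context {R : realType}.

(* 'rV_n carries the sup norm; the Euclidean norm is [enorm]. *)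
Definition dotv {n} (u v : 'rV[R]_n) : R := \sum_i u 0 i * v 0 i.
Definition enorm {n} (u : 'rV[R]_n) : R := Num.sqrt (dotv u u).

Definition mkq (a b c d : R) : 'rV[R]_4 :=
  \row_(k < 4) nth 0 [:: a; b; c; d] k.

Definition qmul (p q : 'rV[R]_4) : 'rV[R]_4 :=
  let p' k := p 0 (inord k) in let q' k := q 0 (inord k) in
  mkq (p' 0%N * q' 0%N - p' 1%N * q' 1%N - p' 2%N * q' 2%N - p' 3%N * q' 3%N)
      (p' 0%N * q' 1%N + p' 1%N * q' 0%N + p' 2%N * q' 3%N - p' 3%N * q' 2%N)
      (p' 0%N * q' 2%N - p' 1%N * q' 3%N + p' 2%N * q' 0%N + p' 3%N * q' 1%N)
      (p' 0%N * q' 3%N + p' 1%N * q' 2%N - p' 2%N * q' 1%N + p' 3%N * q' 0%N).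

Definition qconj (q : 'rV[R]_4) : 'rV[R]_4 :=
  \row_(k < 4) (if k == ord0 then q 0 k else - q 0 k).

Definition qim (q : 'rV[R]_4) : 'rV[R]_3 := \row_(k < 3) q 0 (lift ord0 k).

Definition qpure (u : 'rV[R]_3) : 'rV[R]_4 :=
  \row_(k < 4) (if unlift ord0 k is Some l then u 0 l else 0).

Definition su2T (k : 'I_3) : 'rV[R]_3 := delta_mx 0 k.

Definition su2_bracket (u w : 'rV[R]_3) : 'rV[R]_3 :=
  qim (qmul (qpure u) (qpure w) - qmul (qpure w) (qpure u)).

Definition SU2 (h : 'rV[R]_4) : Prop := enorm h = 1.

(* h u h^-1 *)
Definition Ad (h : 'rV[R]_4) (u : 'rV[R]_3) : 'rV[R]_3 :=
  qim (qmul (qmul h (qpure u)) (qconj h)).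

(* The S^3-component v / |v|; it is 0 at v = 0. *)
Definition sph (v : 'rV[R]_4) : 'rV[R]_4 := (enorm v)^-1 *: v.

(* The left-invariant coframe h^-1 dh = sum_i T_i (x) eta_i of S^3, pulled
   back to R^4 \ 0 by h = v / |v|. The factor qconj (sph v) makes it 0 at
   v = 0. *)
Definition maurer_cartan (v w : 'rV[R]_4) : 'rV[R]_3 :=
  qim (qmul (qconj (sph v)) ('D_w sph v)).

End Quaternions.

(** * Riemannian geometry in a coordinate domain of R^n *)

Section Riemann.
Context {R : realType} {n : nat}.
Implicit Types (G : 'rV[R]_n -> 'M[R]_n) (x : 'rV[R]_n).

Definition bil (M : 'M[R]_n) (u v : 'rV[R]_n) : R := (u *m M *m v^T) 0 0.

Definition coordv (k : 'I_n) : 'rV[R]_n := delta_mx 0 k.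

Definition pd (k : 'I_n) (f : 'rV[R]_n -> R) x : R := 'D_(coordv k) f x.

(* Gamma^k_ij *)
Definition christoffel G (k i j : 'I_n) x : R :=
  2^-1 * \sum_l invmx (G x) k l *
    (pd i (fun y => G y j l) x + pd j (fun y => G y i l) x
     - pd l (fun y => G y i j) x).

(* dx^l (R(d_i, d_j) d_k) *)
Definition riem G (l k i j : 'I_n) x : R :=
  pd i (christoffel G l j k) x - pd j (christoffel G l i k) x
  + \sum_m (christoffel G l i m x * christoffel G m j k x
            - christoffel G l j m x * christoffel G m i k x).

(* < R(d_i, d_j) d_k, d_l > *)
Definition riem_low G (l k i j : 'I_n) x : R :=
  \sum_m G x l m * riem G m k i j x.

Definition ricci G (j k : 'I_n) x : R := \sum_i riem G i k i j x.

Definition scal G x : R := \sum_j \sum_k invmx (G x) j k * ricci G j k x.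

Definition oriented_orthonormal (M P : 'M[R]_n) : Prop :=
  P *m M *m P^T = 1%:M /\ 0 < \det P.

Definition geodesic_on G (U : set 'rV[R]_n) (J : set R) (c : R -> 'rV[R]_n)
    : Prop :=
  forall tau, J tau ->
    [/\ U (c tau), derivable c tau 1, derivable (derive1 c) tau 1
      & forall k, (derive1 (derive1 c) tau) 0 k =
          - \sum_i \sum_j christoffel G k i j (c tau)
                          * (derive1 c tau) 0 i * (derive1 c tau) 0 j].

(* Riemannian exponential map of (U, G), for U open; the value is p when no
   geodesic of U with initial velocity w reaches time 1. *)
Definition riem_exp G (U : set 'rV[R]_n) (p w : 'rV[R]_n) : 'rV[R]_n :=
  xget p [set q | exists (c : R -> 'rV[R]_n) (d : R),
    [/\ 0 < d, geodesic_on G U `](- d), (1 + d)[ c,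
        c 0 = p, derive1 c 0 = w & c 1 = q]].

End Riemann.

Section Riemann4.
Context {R : realType}.

(* The Weyl tensor in dimension 4, with the index conventions of riem_low. *)
Definition weyl (G : 'rV[R]_4 -> 'M[R]_4) (l k i j : 'I_4) (x : 'rV[R]_4) : R :=
  riem_low G l k i j x
  - 2^-1 * (ricci G i l x * G x j k + ricci G j k x * G x i l
            - ricci G i k x * G x j l - ricci G j l x * G x i k)
  + 6^-1 * scal G x * (G x j k * G x i l - G x i k * G x j l).

(* Hodge star alpha = - alpha: for every oriented orthonormal frame (the rows
   of P), the star of alpha takes the value alpha(e_3, e_4) at (e_1, e_2). *)
Definition asd_form (M alpha : 'M[R]_4) : Prop :=
  forall P, oriented_orthonormal M P ->
    bil alpha (row (inord 0) P) (row (inord 1) P)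
    = - bil alpha (row (inord 2) P) (row (inord 3) P).

(* The oriented frames of Lambda^2_+ whose elements have norm sqrt 2: for some
   oriented orthonormal coframe e^0, ..., e^3,
     om_1 = e^01 + e^23, om_2 = e^02 + e^31, om_3 = e^03 + e^12,
   i.e. om_k(e_a, e_b) = < T_k e_a, e_b > in H. The associated almost complex
   structures multiply like i, j, k. *)
Definition sd_frame (M : 'M[R]_4) (om : 'I_3 -> 'M[R]_4) : Prop :=
  exists P, oriented_orthonormal M P /\
    forall k a b, bil (om k) (row a P) (row b P)
                  = dotv (qmul (qpure (su2T k)) (coordv a)) (coordv b).

(* (nabla_m om)(d_i, d_j) *)
Definition cov2 (G om : 'rV[R]_4 -> 'M[R]_4) (m i j : 'I_4) (x : 'rV[R]_4) : R :=
  pd m (fun y => om y i j) x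
  - \sum_l (christoffel G l m i x * om x l j + christoffel G l m j x * om x i l).

End Riemann4.

(** * Orbifolds *)

(* Charts (chart i, chart_group i, chart_map i): chart_map i induces a homeomorphism from the
   quotient of chart i by the finite group chart_group i onto an open set. *)
Record orbifold_data (R : realType) := OrbifoldData {
  carrier : topologicalType;
  cidx : Type;
  chart : cidx -> set 'rV[R]_4;
  chart_group : cidx -> finGroupType;
  chart_act : forall i, chart_group i -> 'rV[R]_4 -> 'rV[R]_4;
  chart_map : cidx -> 'rV[R]_4 -> carrier
}.

Section Orbifold.
Context {R : realType}.

Definition is_change (Z : orbifold_data R) (i j : cidx Z) (V : set 'rV[R]_4)
    (f : 'rV[R]_4 -> 'rV[R]_4) : Prop :=
  [/\ open V /\ V `<=` chart i, f @` V `<=` chart j, smooth_on V f,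
      forall x, V x -> chart_map j (f x) = chart_map i x
    & open (f @` V) /\
      exists f', smooth_on (f @` V) f' /\ forall x, V x -> f' (f x) = x].
Arguments is_change {Z} i j V f.

Record orbifold_axioms (Z : orbifold_data R) : Prop := OrbifoldAxioms {
  carrier_hausdorff : hausdorff_space (carrier Z);
  chart_open : forall i : cidx Z, open (chart i);
  chart_connected : forall i : cidx Z, connected (chart i);
  act1 : forall (i : cidx Z) x, chart i x -> chart_act (1%g : chart_group i) x = x;
  actM : forall (i : cidx Z) (a b : chart_group i) x, chart i x ->
    chart_act (a * b)%g x = chart_act a (chart_act b x);
  act_chart : forall (i : cidx Z) (a : chart_group i) x, chart i x -> chart i (chart_act a x);
  act_smooth : forall (i : cidx Z) (a : chart_group i), smooth_on (chart i) (chart_act a);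
  act_effective : forall (i : cidx Z) (a : chart_group i),
    (forall x, chart i x -> chart_act a x = x) -> a = 1%g;
  fold_continuous : forall (i : cidx Z) x, chart i x ->
    {for x, continuous (chart_map i)};
  fold_open : forall (i : cidx Z) V, open V -> V `<=` chart i ->
    open (chart_map i @` V);
  fold_orbit : forall (i : cidx Z) x y, chart i x -> chart i y ->
    (chart_map i x = chart_map i y <-> exists a : chart_group i, y = chart_act a x);
  fold_cover : forall z : carrier Z, exists (i : cidx Z) x,
    chart i x /\ chart_map i x = z;
  fold_compatible : forall (i j : cidx Z) x y, chart i x -> chart j y ->
    chart_map i x = chart_map j y ->
    exists V f, [/\ V x, f x = y & is_change i j V f]
}.

Record orbifold := Orbifold {
  orb_data :> orbifold_data R;
  orb_axioms : orbifold_axioms orb_data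
}.

Implicit Type Z : orbifold.

(* The standard orientations of the charts are compatible. *)
Definition oriented Z : Prop :=
  forall (i j : cidx Z) V f x, is_change i j V f -> V x ->
    0 < \det (jacobian f x).

Definition local_metrics Z := cidx Z -> 'rV[R]_4 -> 'M[R]_4.

Definition riemannian_metric Z (g : local_metrics Z) : Prop :=
  [/\ forall i, smooth_on (chart i) (g i),
      forall i x, chart i x -> (g i x)^T = g i x,
      forall i x u, chart i x -> u != 0 -> 0 < bil (g i x) u u
    & forall i j V f x u v, is_change i j V f -> V x ->
        bil (g i x) u v = bil (g j (f x)) ('D_u f x) ('D_v f x)].

Definition einstein Z (g : local_metrics Z) : Prop :=
  exists c : R, forall (i : cidx Z) x j k, chart i x ->
    ricci (g i) j k x = c * g i x j k.

Definition scalar_curvature Z (g : local_metrics Z) (s : R) : Prop :=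
  forall (i : cidx Z) x, chart i x -> scal (g i) x = s.

Definition asd_weyl Z (g : local_metrics Z) : Prop :=
  forall (i : cidx Z) x l k, chart i x ->
    asd_form (g i x) (\matrix_(a, b) weyl (g i) l k a b x).

(* The principal SU(2)-orbibundle X lifting the SO(3)-frame bundle of
   Lambda^2_+, trivialized over each chart by a section sigma_i inducing the
   frame [sdf i] of Lambda^2_+. A change of charts f satisfies
   sigma_i(x) = sigma_j(f x) (spin_lift f x), and if p in X induces the frame
   (om_k) then p h induces the frame (sum_l Ad(h)_lk om_l). *)
Record spin_bundle Z (g : local_metrics Z) := SpinBundle {
  sdf : cidx Z -> 'rV[R]_4 -> 'I_3 -> 'M[R]_4;
  spin_lift : forall i j : cidx Z,
    ('rV[R]_4 -> 'rV[R]_4) -> 'rV[R]_4 -> 'rV[R]_4;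
  sdf_smooth : forall i k, smooth_on (chart i) (fun x => sdf i x k);
  sdf_frame : forall i x, chart i x -> sd_frame (g i x) (sdf i x);
  lift_smooth : forall i j V f, is_change i j V f ->
    smooth_on V (spin_lift i j f);
  lift_SU2 : forall i j V f x, is_change i j V f -> V x ->
    SU2 (spin_lift i j f x);
  lift_local : forall i j V f f', is_change i j V f ->
    is_change i j V f' -> (forall x, V x -> f x = f' x) ->
    forall x, V x -> spin_lift i j f x = spin_lift i j f' x;
  lift_cocycle : forall i j k V W f f', is_change i j V f ->
    is_change j k W f' -> f @` V `<=` W ->
    forall x, V x ->
      spin_lift i k (f' \o f) x = qmul (spin_lift j k f' (f x)) (spin_lift i j f x);
  lift_frame : forall i j V f x k u v, is_change i j V f -> V x ->
    bil (sdf i x k) u v =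
    \sum_l Ad (spin_lift i j f x) (su2T k) 0 l
           * bil (sdf j (f x) l) ('D_u f x) ('D_v f x)
}.

(* a_i = sigma_i^* eta, a matrix sending a tangent vector to su(2). *)
Definition local_connections Z := cidx Z -> 'rV[R]_4 -> 'M[R]_(4, 3).

(* eta is induced by the Levi-Civita connection: Lambda^2_+ is the bundle
   associated with the adjoint representation, the frame (om_k) corresponding
   to (T_k), so nabla om_k = sum_l [a, T_k]_l om_l. With these conventions
   F_eta = - (s / 24) sum_k om_k (x) T_k when g is Einstein with
   anti-self-dual Weyl tensor. *)
Definition levi_civita Z (g : local_metrics Z) (X : spin_bundle g)
    (a : local_connections Z) : Prop :=
  (forall i, smooth_on (chart i) (a i)) /\
  forall i x k m p q, chart i x ->
    cov2 (g i) (fun y => sdf X i y k) m p q x =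
    \sum_l su2_bracket (row m (a i x)) (su2T k) 0 l * sdf X i x l p q.

End Orbifold.

(** * The geometry of E *)

(* The profile functions; derivatives are one-sided at r = 0. *)
Section Profile.
Context {R : realType}.

Definition has_deriv_ge0 (f : R -> R) (r l : R) : Prop :=
  (f u - f r) / (u - r) @[u --> within [set u | 0 <= u] (r^')] --> l.

Definition profile (nu0 : R) (t nu : R -> R) : Prop :=
  [/\ t 0 = 0, nu 0 = nu0
    & forall r, 0 <= r ->
        has_deriv_ge0 (fun u => nu u ^+ 2) r (6 * t r) /\
        has_deriv_ge0 t r (1 - 2 * t r ^+ 2 / nu r ^+ 2)].

Definition int0 (t : R -> R) (r : R) : R :=
  \int[lebesgue_measure]_(u in `[0, r]) t u.

End Profile.

(* E is covered by the orbifold charts chart i x H, where (x, v) stands for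
   [sigma_i(x), v] and is the row vector row_mx x v; a change of charts f acts
   by (x, v) |-> (f x, (spin_lift f x) v). Off the zero section, (r, p)
   in (0, oo) x X, with p = sigma_i(x) h, is the point (x, v) with v = r h. *)
Section SpinorBundle.
Context {R : realType} (Z : orbifold (R := R)).
Context (g : local_metrics Z) (a : local_connections Z) (s : R)
        (t nu : R -> R).
Implicit Types (i : cidx Z) (p xi zeta : 'rV[R]_(4 + 4)).

Definition Edom i : set 'rV[R]_(4 + 4) := [set p | chart i (lsubmx p)].

Definition Edom_punctured i : set 'rV[R]_(4 + 4) :=
  [set p | chart i (lsubmx p) /\ rsubmx p != 0].

Definition radius p : R := enorm (rsubmx p).

(* eta = h^-1 a h + h^-1 dh with h = v / |v|. *)
Definition eta i p xi : 'rV[R]_3 :=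
  let h := sph (rsubmx p) in
  qim (qmul (qmul (qconj h) (qpure (lsubmx xi *m a i (lsubmx p)))) h)
  + maurer_cartan (rsubmx p) (rsubmx xi).

(* dr^2 + t^2 sum_i eta_i^2 + (s nu^2 / 48) pi^* g_Z, extended smoothly over
   v = 0, where dr^2 + t^2 sum_i eta_i^2 tends to |dv|^2. *)
Definition gTheta i p xi zeta : R :=
  (if rsubmx p == 0 then dotv (rsubmx xi) (rsubmx zeta)
   else 'D_xi radius p * 'D_zeta radius p
        + t (radius p) ^+ 2 * dotv (eta i p xi) (eta i p zeta))
  + s * nu (radius p) ^+ 2 / 48 * bil (g i (lsubmx p)) (lsubmx xi) (lsubmx zeta).

Definition gTheta_mx i p : 'M[R]_(4 + 4) :=
  \matrix_(k, l) gTheta i p (coordv k) (coordv l).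

(* Connections are su(2)-valued 1-forms p |-> xi |-> A p xi, in the
   tautological trivialization of pi^* E over E \ Z. Since eta is 0 at v = 0,
   [A_inst] takes there the value of its smooth extension. *)
Definition A_inst (y0 : R) i p xi : 'rV[R]_3 :=
  (y0 * t (radius p) ^+ 2 / (1 + 2 * y0 * int0 t (radius p))) *: eta i p xi.

Definition A_lim i p xi : 'rV[R]_3 :=
  (t (radius p) ^+ 2 / (2 * int0 t (radius p))) *: eta i p xi.

(* For z = chart_map i x and p = sigma_i(x) h in X_z, the isometry
   R^4 -> N_z Z = E_z is q |-> [p, q] = (x, h q). Geodesics of the orbifold E
   starting at z are those of its chart Edom i starting at (x, 0). *)
Definition s_map i (x h : 'rV[R]_4) (lam : R) (q : 'rV[R]_4)
    : 'rV[R]_(4 + 4) :=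
  riem_exp (gTheta_mx i) (Edom i) (row_mx x 0) (row_mx 0 (lam *: qmul h q)).

End SpinorBundle.

Section Forms.
Context {R : realType}.

Definition pullback {V V' : normedModType R} (f : V -> V')
    (A : V' -> V' -> 'rV[R]_3) (q w : V) : 'rV[R]_3 := A (f q) ('D_w f q).

(* Coefficients are taken along constant vector fields of the chart. *)
Definition cvg_form {V : normedModType R} (U K : set V)
    (A_ : nat -> V -> V -> 'rV[R]_3) (A : V -> V -> 'rV[R]_3) : Prop :=
  forall w : V, cvg_smooth U K (fun n x => A_ n x w) (fun x => A x w).

Definition A_asd (kappa : R) (q w : 'rV[R]_4) : 'rV[R]_3 :=
  (kappa * enorm q ^+ 2 / (1 + kappa * enorm q ^+ 2)) *: maurer_cartan q w.

Definition B1 : set 'rV[R]_4 := [set q | enorm q < 1].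

End Forms.

(* Main.v *)
(* By the profile equations, t and nu ^ 2 extend to smooth odd and even functions
   of r, so that t = r theta and 2 \int_0^r t = r ^ 2 iota with theta and iota
   smooth, even and equal to 1 at 0. As eta = |v| ^ -2 Im (conj v (dv + a v)) in
   the charts of E,
     A_{y0} = theta ^ 2 / (1 / y0 + |v| ^ 2 iota) Im (conj v (dv + a v)),
   which off the zero section is smooth in (1 / y0, x, v) up to 1 / y0 = 0, where
   it is A_lim: this is (b). For (a), write
     g_Theta = theta ^ 2 |Dv| ^ 2 + chi <v, dv> ^ 2 + (s nu ^ 2 / 48) g_Z,
   with Dv = dv + a v and theta ^ 2 + r ^ 2 chi = 1. The rays of the fibers are
   geodesics of this smooth metric, so s_{z, lam} (q) = (x, lam h q) in a chart.
   With lam = sqrt (kappa / y0) the pulled back connection is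
     kappa theta ^ 2 / (1 + kappa |q| ^ 2 iota) Im (conj q dq),
   where theta and iota are taken at lam |q|. It is smooth in (lam, q), and at
   lam = 0 it is the bubble. *)

Require Import Defs.
From HB Require Import structures.
From mathcomp Require Import all_boot all_order all_algebra all_fingroup.
From mathcomp Require Import all_classical all_reals all_analysis.
From mathcomp Require Import ring lra.
Set Implicit Arguments.
Unset Strict Implicit.
Unset Printing Implicit Defensive.
Import Order.TTheory GRing.Theory Num.Theory.
Import numFieldNormedType.Exports.
Local Open Scope classical_set_scope.
Local Open Scope ring_scope.

(** * Functions of class C^k *)

(** The profile is given only for [r >= 0], with one-sided derivatives at 0 and no smoothness or
    positivity of [t] and [nu] for [r > 0]. The equations force all of it: the odd extension of [t]
    and the even extension of [nu ^ 2] solve the same system on the whole line, a zero of [t] has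
    slope 1, and the system bootstraps its own regularity. The radius is not smooth at the zero
    section, so no chain rule passes through [|v|] there. The operator [phi |-> phi' / r] replaces
    it: it preserves smooth even functions, and half of it is differentiation in [r ^ 2], which is
    smooth in [v]. Removable quotients such as [t / r] are controlled by a family of singular linear
    equations that is closed under differentiation. The exponential map is a choice among endpoints
    of geodesics, so it is not enough that rays are geodesics: a different endpoint for the same
    initial data must be excluded. This takes an invertible metric, smooth Christoffel symbols and a
    Gronwall estimate in phase space. *)

Lemma near_shift0 {R : realType} {V : normedModType R} (P : V -> Prop) (x : V) :
  (\forall y \near x, P y) -> \forall h \near 0, P (h + x).
Proof.
rewrite (near_shift 0 x); apply: filterS => h.
by rewrite /= subr0.
Qed.

Section Differentiability.
Context {R : realType} {V W : normedModType R}.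
Implicit Types (f g : V -> W) (x v : V).

Lemma is_diff_of_bound f (L : {linear V -> W}) x : continuous L ->
  (forall e : R, 0 < e -> \forall h \near 0, `|f (h + x) - f x - L h| <= e * `|h|) ->
  is_diff x f L.
Proof.
move=> Lc H.
have E : f \o shift x = cst (f x) + L +o_ 0 id.
  apply/eqaddoP => e e0; near=> h.
  have -> : (f \o shift x - (cst (f x) + (L : V -> W))) h = f (h + x) - f x - L h.
    by rewrite opprD addrA.
  by near: h; exact: H.
have dL := diff_unique Lc E.
split => //; apply/diff_locallyP; rewrite dL; split => //.
Unshelve. all: by end_near. Qed.

Lemma near_eq_is_diff f g x : (\forall y \near x, f y = g y) ->
  differentiable f x -> differentiable g x.
Proof.
move=> fg df; suff [] : is_diff x g ('d f x) by [].
apply: (is_diff_of_bound (L := 'd f x)); first exact: diff_continuous.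
move=> e e0; have [_ /eqaddoP/(_ e e0) H] := (diff_locallyP x f).1 df.
have fg0 : \forall h \near (0 : V), f (h + x) = g (h + x).
  exact: (near_shift0 (P := fun z => f z = g z)).
near=> h.
have -> : g (h + x) = f (h + x) by rewrite (near fg0 h).
rewrite -(nbhs_singleton fg) -addrA -opprD.
by near: h; exact: H.
Unshelve. all: by end_near. Qed.

End Differentiability.

Section SlopeChain.
Context {R : realType} {V : normedModType R}.

(** The chain rule in Caratheodory's form: the slope of [f] against [P] only has to be continuous at
    [x]. It serves for functions of [sqrt P] at zeros of [P], where the square root itself has no
    derivative. *)
Lemma is_diff_slope (f P c : V -> R) x :
  (\forall y \near x, f y - f x = c y * (P y - P x)) ->
  {for x, continuous c} -> differentiable P x ->
  is_diff x f (fun v => c x * 'd P x v).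
Proof.
move=> fcP cc dP.
have dcP : differentiable (c x *: P) x by exact: differentiableZ.
have E : (fun v => c x * 'd P x v) = 'd (c x *: P) x by rewrite diffZ.
rewrite E; apply: (@is_diff_of_bound _ _ _ f ('d (c x *: P) x)).
  exact: diff_continuous.
rewrite -E => e e0.
have [k k0 kP] := linear_lipschitz (@diff_continuous _ _ _ _ _ dP).
have [_ /eqaddoP H] := (diff_locallyP x P).1 dP.
pose C := `|c x| + 1.
have C0 : 0 < C by rewrite ltr_wpDl.
have h0 : \forall h \near (0 : V), f (h + x) - f x = c (h + x) * (P (h + x) - P x).
  exact: (near_shift0 (P := fun z => f z - f x = c z * (P z - P x))).
(* Each half of [e] pays for one term of the splitting below. The cap 1 in the minimum of [h2]
   bounds the increment of [P] by [(k + 1) |h|], with [k] a Lipschitz constant of its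
   differential. *)
pose d := e / 2 / (k + 1).
have d0 : 0 < d by rewrite !divr_gt0 // addr_gt0.
have h1 : \forall h \near (0 : V), `|c x - c (h + x)| <= d.
  apply: (near_shift0 (P := fun z => `|c x - c z| <= d)).
  by move/cvgrPdist_le : cc; exact.
have h2 : \forall h \near (0 : V), `|P (h + x) - P x - 'd P x h| <= Num.min 1 (e / 2 / C) * `|h|.
  have m0 : 0 < Num.min 1 (e / 2 / C) by rewrite lt_min ltr01 /= !divr_gt0.
  apply: filterS (H _ m0) => h /=.
  by rewrite -[X in `|X|]/(P (h + x) - (P x + 'd P x h)) opprD addrA.
near=> h.
rewrite (near h0 h) //.
have -> : c (h + x) * (P (h + x) - P x) - c x * 'd P x h =
  (c (h + x) - c x) * (P (h + x) - P x) + c x * (P (h + x) - P x - 'd P x h) by ring.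
have b2 := near h2 h.
have {}b2 : `|P (h + x) - P x - 'd P x h| <= Num.min 1 (e / 2 / C) * `|h| by apply: b2.
have b2' : `|P (h + x) - P x - 'd P x h| <= `|h|.
  by apply: (le_trans b2); rewrite ler_piMl // ge_min lexx.
have b2'' : `|P (h + x) - P x - 'd P x h| <= e / 2 / C * `|h|.
  by apply: (le_trans b2); rewrite ler_wpM2r // ge_min lexx orbT.
have b1 : `|c (h + x) - c x| <= d by rewrite distrC; near: h.
have b3 : `|P (h + x) - P x| <= (k + 1) * `|h|.
  rewrite -(subrK ('d P x h) (P _ - _)) (le_trans (ler_normD _ _)) //.
  by rewrite mulrDl mul1r addrC lerD.
rewrite (le_trans (ler_normD _ _)) // !normrM (splitr e) mulrDl lerD //.
  rewrite (le_trans (ler_pM _ _ b1 b3)) // /d mulrA divfK //.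
  by rewrite gt_eqF // addr_gt0.
rewrite (le_trans (ler_wpM2l _ b2'')) // mulrCA mulrA ler_wpM2r //.
rewrite mulrAC ler_pdivrMr // ler_wpM2l ?divr_ge0 ?ltW //.
by rewrite ltrDl.
Unshelve. all: by end_near. Qed.

End SlopeChain.

Section Ck.
Context {R : realType}.

(** [iter_deriv] adds derivatives on the outside, whereas [Ck] peels off the innermost one. An
    induction on [n] generalized over [f] can then substitute a formula for the first derivative,
    such as the Leibniz rule. *)
Fixpoint Ck {V W : normedModType R} (n : nat) (U : set V) (f : V -> W) : Prop :=
  if n is n'.+1 then
    (forall x, U x -> differentiable f x) /\ (forall v, Ck n' U ('D_v f))
  else True.

Context {V W : normedModType R}.
Implicit Types (U : set V) (f g : V -> W) (n : nat).

Lemma iter_deriv_rcons (vs : seq V) v f :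
  iter_deriv (rcons vs v) f = iter_deriv vs ('D_v f).
Proof. by elim: vs => //= w vs ->. Qed.

Lemma smooth_on_Ck U f : smooth_on U f <-> forall n, Ck n U f.
Proof.
split=> [+ n|].
  elim: n f => //= n IHn f Uf; split=> [x Ux|v]; first exact: (Uf [::]).
  by apply: IHn => vs x Ux; rewrite -iter_deriv_rcons; exact: Uf.
move=> Uf vs; elim/last_ind: vs f Uf => [|vs v IHvs] f Uf x Ux /=.
  exact: (Uf 1%N).1.
rewrite iter_deriv_rcons; apply: IHvs => // n.
exact: (Uf n.+1).2.
Qed.

Lemma near_open (P : V -> Prop) U x : open U -> U x -> (forall y, U y -> P y) ->
  \forall y \near x, P y.
Proof. by move=> oU Ux UP; near do apply: UP; exact: open_nbhs_nbhs.
Unshelve. all: by end_near. Qed.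

Lemma Ck_eq n U f g : open U -> (forall x, U x -> f x = g x) ->
  Ck n U f -> Ck n U g.
Proof.
move=> oU; elim: n f g => //= n IHn f g fg [df Df]; split=> [x Ux|v].
  by apply: (@near_eq_is_diff _ _ _ f); [exact: near_open Ux fg|exact: df].
apply: IHn (Df v) => x Ux; apply: near_eq_derive; exact: near_open Ux fg.
Qed.

Lemma Ck_mono n U f : Ck n.+1 U f -> Ck n U f.
Proof.
elim: n f => //= n IHn f [df Df]; split=> // v; apply: IHn; exact: Df.
Qed.

Lemma Ck_sub n U U' f : U' `<=` U -> Ck n U f -> Ck n U' f.
Proof.
move=> UU'; elim: n f => //= n IHn f [df Df]; split=> [x /UU'/df//|v].
exact: IHn.
Qed.

Lemma Ck_cst n U (c : W) : Ck n U (fun _ => c).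
Proof.
elim: n c => //= n IHn c; split=> [x _|v]; first exact: differentiable_cst.
rewrite (_ : 'D_v _ = fun _ => 0) ?funeqE // => x.
exact: derive_cst.
Qed.

Lemma Ck_linear n U (f : V -> W) : (forall x, differentiable f x) ->
  (forall h v x, f (h *: v + x) = h *: f v + f x) -> Ck n U f.
Proof.
case: n => //= n df lf; split=> // v.
rewrite (_ : 'D_v _ = fun _ => f v); first exact: Ck_cst.
rewrite funeqE => x; rewrite /derive; apply: cvg_lim => //.
apply: cvg_near_cst; near=> h.
rewrite /= lf addrK scalerA mulVf ?scale1r //.
by near: h; exact: nbhs_dnbhs_neq.
Unshelve. all: by end_near. Qed.

Lemma Ck_add n U f g : open U -> Ck n U f -> Ck n U g ->
  Ck n U (fun x => f x + g x).
Proof.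
move=> oU; elim: n f g => //= n IHn f g [df Df] [dg Dg].
split=> [x Ux|v]; first by apply: differentiableD; [exact: df|exact: dg].
apply: Ck_eq (IHn _ _ (Df v) (Dg v)) => // x Ux.
by rewrite -deriveD //; apply: diff_derivable; [exact: df|exact: dg].
Qed.

Lemma Ck_sum n U I (s : seq I) (P : pred I) (F : I -> V -> W) : open U ->
  (forall i, Ck n U (F i)) -> Ck n U (fun x => \sum_(i <- s | P i) F i x).
Proof.
move=> oU FU; elim: s => [|i s IHs].
  rewrite (_ : (fun _ => _) = fun _ => 0); first exact: Ck_cst.
  by rewrite funeqE => x; rewrite big_nil.
case Pi : (P i).
  apply: Ck_eq (Ck_add oU (FU i) IHs) => // x _.
  by rewrite big_cons Pi.
by apply: Ck_eq IHs => // x _; rewrite big_cons Pi.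
Qed.

End Ck.

Lemma Ck_continuous_at {R : realType} {V W : normedModType R} n (U : set V)
  (f : V -> W) x : Ck n.+1 U f -> U x -> {for x, continuous f}.
Proof. by move=> [df _] Ux; apply: differentiable_continuous; exact: df. Qed.

Section CkComp.
Context {R : realType} {V V' W : normedModType R}.

Lemma derive_comp_affine (f : V' -> W) (L : V -> V') (l : V -> V') v x :
  (forall h, L (h *: v + x) = h *: l v + L x) ->
  'D_v (f \o L) x = 'D_(l v) f (L x).
Proof.
move=> lL; rewrite /derive.
set d := (X in lim (X @ _)); set d' := (X in _ = lim (X @ _)).
by suff -> : d = d' by []; rewrite funeqE => h; rewrite /d /d' /= lL.
Qed.

(** For an affine inner map [L] with linear part [l], the derivative along [v] is the single
    derivative of [f] along [l v], so the induction never leaves compositions with [L]. *)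
Lemma Ck_comp_affine n (U : set V) (U' : set V') (f : V' -> W) (L : V -> V')
    (l : V -> V') :
  (forall x, differentiable L x) ->
  (forall h v x, L (h *: v + x) = h *: l v + L x) ->
  (forall x, U x -> U' (L x)) -> Ck n U' f -> Ck n U (fun x => f (L x)).
Proof.
move=> dL lL UL; elim: n f => //= n IHn f [df Df]; split=> [x Ux|v].
  by apply: differentiable_comp => //; apply: df; exact: UL.
rewrite (_ : 'D_v _ = fun x => 'D_(l v) f (L x)).
  exact: (IHn ('D_(l v) f)).
by rewrite funeqE => x; exact: derive_comp_affine.
Qed.

End CkComp.

Section CkScalar.
Context {R : realType} {V : normedModType R}.
Implicit Types (U : set V) (f g : V -> R) (n : nat).

Lemma Ck_mul n U f g : open U -> Ck n U f -> Ck n U g ->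
  Ck n U (fun x => f x * g x).
Proof.
move=> oU; elim: n f g => //= n IHn f g [df Df] [dg Dg].
split=> [x Ux|v]; first by apply: differentiableM; [exact: df|exact: dg].
have Cf : Ck n U f by apply: Ck_mono.
have Cg : Ck n U g by apply: Ck_mono.
apply: Ck_eq (Ck_add oU (IHn _ _ Cf (Dg v)) (IHn _ _ Cg (Df v))) => // x Ux.
by rewrite deriveM //; apply: diff_derivable; [exact: df|exact: dg].
Qed.

Lemma Ck_opp n U f : open U -> Ck n U f -> Ck n U (fun x => - f x).
Proof.
move=> oU Cf; apply: Ck_eq (Ck_mul (f := fun=> -1) oU (Ck_cst _ _ _) Cf) => // x _.
by rewrite mulN1r.
Qed.

Lemma Ck_inv n U f : open U -> (forall x, U x -> f x != 0) -> Ck n U f ->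
  Ck n U (fun x => (f x)^-1).
Proof.
move=> oU f0; elim: n => //= n IHn [df Df].
split=> [x Ux|v]; first by apply: differentiableV; [exact: df|exact: f0].
have CV : Ck n U (fun x => (f x)^-1) by apply: IHn; apply: Ck_mono.
apply: Ck_eq (Ck_opp oU (Ck_mul oU (Ck_mul oU CV CV) (Df v))) => // x Ux.
rewrite deriveV ?f0 //; last by apply: diff_derivable; exact: df.
by rewrite -[RHS]/(- f x ^- 2 * 'D_v f x) mulNr -exprVn expr2.
Qed.

Lemma Ck_exp n U f k : open U -> Ck n U f -> Ck n U (fun x => f x ^+ k).
Proof.
move=> oU Cf; elim: k => [|k IHk]; first exact: Ck_cst.
by apply: Ck_eq (Ck_mul oU Cf IHk) => // x _; rewrite exprS.
Qed.

Lemma Ck_prod n U I (s : seq I) (P : pred I) (F : I -> V -> R) : open U ->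
  (forall i, Ck n U (F i)) -> Ck n U (fun x => \prod_(i <- s | P i) F i x).
Proof.
move=> oU FU; elim: s => [|i s IHs].
  rewrite (_ : (fun _ => _) = fun _ => 1); first exact: Ck_cst.
  by rewrite funeqE => x; rewrite big_nil.
case Pi : (P i).
  apply: Ck_eq (Ck_mul oU (FU i) IHs) => // x _.
  by rewrite big_cons Pi.
by apply: Ck_eq IHs => // x _; rewrite big_cons Pi.
Qed.

End CkScalar.

Section CkMatrix.
Context {R : realType} {V : normedModType R} {m p : nat}.
Implicit Types (U : set V) (A : V -> 'M[R]_(m, p)).

Lemma Ck_coord n U A i j : open U -> Ck n U A -> Ck n U (fun x => A x i j).
Proof.
move=> oU; elim: n A => //= n IHn A [dA DA]; split=> [x Ux|v].
  apply: (differentiable_comp (g := fun M : 'M[R]_(m, p) => M i j)).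
    exact: dA.
  exact: differentiable_coord.
apply: Ck_eq (IHn _ (DA v)) => // x Ux.
by rewrite derive_mx ?mxE //; apply: diff_derivable; exact: dA.
Qed.

Lemma differentiable_mx A x :
  (forall i j, differentiable (fun y => A y i j) x) -> differentiable A x.
Proof.
move=> dA.
have E : A = \sum_(k < m) \sum_(l < p) (fun y => A y k l *: delta_mx k l).
  rewrite funeqE => y; rewrite [LHS]matrix_sum_delta fct_sumE.
  by apply: eq_bigr => k _; rewrite fct_sumE.
rewrite E; apply: differentiable_sum => k; apply: differentiable_sum => l.
by apply: differentiableZl; exact: dA.
Qed.

Lemma Ck_mx n U A : open U -> (forall i j, Ck n U (fun x => A x i j)) ->
  Ck n U A.
Proof.
move=> oU; elim: n A => //= n IHn A CA; split=> [x Ux|v].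
  by apply: differentiable_mx => i j; exact: (CA i j).1.
apply: IHn => i j; apply: Ck_eq ((CA i j).2 v) => // x Ux.
rewrite derive_mx ?mxE //; apply: diff_derivable.
by apply: differentiable_mx => k l; exact: (CA k l).1.
Qed.

End CkMatrix.

(** * Families depending smoothly on a parameter *)

Section Slices.
Context {R : realType} {V W : normedModType R}.

Lemma iter_deriv_eq (U : set V) (vs : seq V) (f g : V -> W) : open U ->
  (forall x, U x -> f x = g x) ->
  forall x, U x -> iter_deriv vs f x = iter_deriv vs g x.
Proof.
move=> oU fg; elim: vs => //= v vs IHvs x Ux.
by apply: near_eq_derive; exact: near_open Ux IHvs.
Qed.

Lemma iter_deriv_slice (F : R * V -> W) (mu : R) (vs : seq V) :
  iter_deriv vs (fun x => F (mu, x)) =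
  (fun x => iter_deriv [seq (0, v) | v <- vs] F (mu, x)).
Proof.
elim: vs => //= v vs ->; rewrite funeqE => x.
rewrite -(@derive_comp_affine _ _ _ _ _ (fun y => (mu, y)) (fun w => (0, w))) //.
move=> h; congr (_, _); first by rewrite /= scaler0 add0r.
Qed.

Lemma differentiable_slice (mu : R) (x : V) :
  differentiable (fun y : V => (mu, y)) x.
Proof. exact: differentiable_pair. Qed.

(* Smoothness in the parameter mu as well turns the uniform convergence of all
   derivatives into continuity on a compact set. *)
Lemma cvg_smooth_slice (Om : set (R * V)) (F : R * V -> W) (U K K' : set V)
    (mu : nat -> R) (f_ : nat -> V -> W) (f : V -> W) :
  open Om -> open U -> compact K' -> K `<=` U -> K `<=` K' ->
  (forall n, Ck n Om F) ->
  (forall x, K' x -> Om (0, x)) -> (forall x, U x -> Om (0, x)) ->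
  (forall n x, U x -> Om (mu n, x)) ->
  mu n @[n --> \oo] --> 0 ->
  (forall n x, U x -> F (mu n, x) = f_ n x) ->
  (forall x, U x -> F (0, x) = f x) ->
  cvg_smooth U K f_ f.
Proof.
move=> oO oU cK' KU KK' CF OK' OU Omu mu0 Ff_ Ff.
have sF nu : (forall x, U x -> Om (nu, x)) -> smooth_on U (fun x => F (nu, x)).
  move=> Onu; apply/smooth_on_Ck => n.
  apply: (@Ck_comp_affine _ _ _ _ n U Om F (fun y => (nu, y)) (fun w => (0, w)))
    => //.
  by move=> h v x; congr (_, _); rewrite /= scaler0 add0r.
split.
- near=> n; apply/smooth_on_Ck => k.
  have /smooth_on_Ck/(_ k) := sF _ (Omu n).
  by apply: Ck_eq => // x Ux; exact: Ff_.
- apply/smooth_on_Ck => k.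
  have /smooth_on_Ck/(_ k) := sF _ OU.
  by apply: Ck_eq => // x Ux; exact: Ff.
move=> vs e e0.
pose H := iter_deriv [seq ((0 : R), v) | v <- vs] F.
have cH x : K' x -> {for (0, x), continuous H}.
  move=> /OK' Ox; apply: differentiable_continuous.
  by have /smooth_on_Ck := CF; apply.
(* Tube argument: near each [(0, x)] the values of [H] at [(nu, x')] and at [(0, x')] both lie
   within [e / 2] of [H (0, x)], and compactness of [K'] yields one neighbourhood of 0 in [nu] for
   all [x]. *)
have unif : \forall nu \near (0 : R), K' `<=` [set x | `|H (nu, x) - H (0, x)| < e].
  have /compact_near_coveringP cvK := cK'.
  apply: (cvK R (nbhs (0 : R)) (fun nu x => `|H (nu, x) - H (0, x)| < e)) => x K'x.
  have /cvgrPdist_lt/(_ (e / 2)) := cH x K'x.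
  rewrite divr_gt0 // => /(_ isT) Hx.
  have Hx0 : \forall x' \near x, `|H (0, x) - H (0, x')| < e / 2.
    have c0 : (fun y : V => ((0 : R), y)) @ x --> ((0 : R), x).
      exact: (differentiable_continuous (differentiable_slice 0 x)).
    exact: (c0 _ Hx).
  have {}Hx : \forall x' \near x & nu \near (0 : R), `|H (0, x) - H (nu, x')| < e / 2.
    by case: Hx => -[A B] /= [A0 Bx] AB; exists (B, A) => //= -[y nu] [/= By Anu]; apply: AB.
  have {}Hx0 : \forall x' \near x & nu \near (0 : R), `|H (0, x) - H (0, x')| < e / 2.
    by exists ([set x' | `|H (0, x) - H (0, x')| < e / 2], setT);
      [split=> //; exact: filterT|move=> [y nu] []].
  apply: filterS2 Hx Hx0 => -[y nu] /= h1 h2.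
  rewrite -(subrKA (H (0, x))) (splitr e) (le_lt_trans (ler_normD _ _)) //.
  by rewrite ltrD // distrC.
near=> n => x Kx.
rewrite -(iter_deriv_eq vs oU (Ff_ n)); last exact: KU.
rewrite -(iter_deriv_eq vs oU Ff); last exact: KU.
rewrite !iter_deriv_slice.
have nun : K' `<=` [set x | `|H (mu n, x) - H (0, x)| < e].
  by near: n; exact: (mu0 _ unif).
exact/nun/KK'.
Unshelve. all: by end_near. Qed.

End Slices.

(** * Even functions of one variable *)

Section OneVariable.
Context {R : realType}.
Implicit Types (f g q phi : R -> R) (r x : R).

Lemma is_derive_funD f g x (df dg : R) : is_derive x 1 f df ->
  is_derive x 1 g dg -> is_derive x 1 (fun y => f y + g y) (df + dg).
Proof. by move=> ? ?; exact: is_deriveD. Qed.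

Lemma is_derive_funB f g x (df dg : R) : is_derive x 1 f df ->
  is_derive x 1 g dg -> is_derive x 1 (fun y => f y - g y) (df - dg).
Proof. by move=> ? ?; exact: is_deriveB. Qed.

Lemma is_derive_funM f g x (df dg : R) : is_derive x 1 f df ->
  is_derive x 1 g dg ->
  is_derive x 1 (fun y => f y * g y) (df * g x + f x * dg).
Proof.
move=> Hf Hg; apply: (is_derive_eq (is_deriveM Hf Hg)).
by rewrite /GRing.scale /=; ring.
Qed.

Lemma is_derive_funX x n : is_derive x 1 (fun y => y ^+ n.+1) (n.+1%:R * x ^+ n).
Proof.
rewrite (_ : (fun y => _) = (id : R -> R) ^+ n.+1); last first.
  by rewrite funeqE => y; rewrite exprfctE.
apply: (is_derive_eq (is_deriveX n.+1 (is_derive_id x 1))).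
by rewrite /GRing.scale /= mulr1.
Qed.

Lemma is_derive_funV f x (df : R) : f x != 0 -> is_derive x 1 f df ->
  is_derive x 1 (fun y => (f y)^-1) (- (f x) ^- 2 * df).
Proof. by move=> f0 Hf; exact: is_deriveV. Qed.

Lemma derive_line f v x : derivable f x 1 -> 'D_v f x = v * derive1 f x.
Proof.
move=> /derivable1_diffP df; rewrite derive1E !deriveE //.
by rewrite -[in LHS](mulr1 v) -[v * 1]/(v *: 1) linearZ.
Qed.

Lemma Ck_line n f : (forall x, derivable f x 1) -> Ck n setT (derive1 f) ->
  Ck n.+1 setT f.
Proof.
move=> df Df; split=> [x _|v]; first exact/derivable1_diffP.
apply: Ck_eq (Ck_mul (f := fun=> v) openT (Ck_cst _ _ _) Df) => [|x _].
  exact: openT.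
by rewrite derive_line.
Qed.

Lemma Ck_derivable n f x : Ck n.+1 setT f -> derivable f x 1.
Proof. by move=> [df _]; apply/derivable1_diffP; exact: df. Qed.

Lemma Ck_derive1 n f : Ck n.+1 setT f -> Ck n setT (derive1 f).
Proof.
move=> [_ /(_ 1)]; rewrite (_ : 'D_1 f = derive1 f) // funeqE => x.
by rewrite derive1E.
Qed.

Lemma within_continuousT f (A : set R) : (forall x, {for x, continuous f}) ->
  {within A, continuous f}.
Proof. by move=> cf; apply: continuous_subspaceT => x; exact: cf. Qed.

(** A mean value theorem based at 0 that assumes no derivative there and returns a point [c] away
    from 0, where the singular equations below may be used. *)
Lemma MVT_at0 f : {for 0, continuous f} ->
  (forall r, r != 0 -> derivable f r 1) ->
  forall r, r != 0 ->
  exists c, [/\ c != 0, `|c| <= `|r| & f r - f 0 = derive1 f c * r].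
Proof.
move=> cf df r r0.
have cf' x : {for x, continuous f}.
  have [->//|x0] := eqVneq x 0.
  by apply: differentiable_continuous; apply/derivable1_diffP; exact: df.
have der x : x != 0 -> is_derive x 1 f (derive1 f x).
  by move=> x0; split; [exact: df|rewrite derive1E].
have [r_lt0|r_gt0|] := ltgtP r 0; last by move/eqP; rewrite (negPf r0).
- have [||c cr E] := MVT r_lt0 (f := f) (df := derive1 f).
  + by move=> x /itvP xr; apply: der; rewrite lt_eqF ?xr.
  + exact: within_continuousT.
  exists c; split.
  + by rewrite lt_eqF ?(itvP cr).
  + by rewrite !ltr0_norm ?(itvP cr) // lerN2 ltW ?(itvP cr).
  + by rewrite -opprB E sub0r mulrN opprK.
- have [||c cr E] := MVT r_gt0 (f := f) (df := derive1 f).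
  + by move=> x /itvP xr; apply: der; rewrite gt_eqF ?xr.
  + exact: within_continuousT.
  exists c; split.
  + by rewrite gt_eqF ?(itvP cr).
  + by rewrite !gtr0_norm ?(itvP cr) // ltW ?(itvP cr).
  + by rewrite E subr0.
Qed.

(* q solves r q' + (k + 1) q = g off 0: for k = 0 and g = f' this is
   q = f / r, and differentiating raises k by one. *)
Definition euler_ode (k : nat) g q :=
  [/\ {for 0, continuous q}, (forall r, r != 0 -> derivable q r 1) &
      forall r, r != 0 -> r * derive1 q r = g r - k.+1%:R * q r].

(** The equation makes [q'] cancel in the derivative of [r^(k+1) (g - (k+1) q)], which is just
    [r^(k+1) g']. Subtracting [L r^(k+2)] gives [M = r^(k+2) (q' - L)] with
    [M' = r^(k+1) (g' - g'(0))], and the mean value theorem for [M] bounds [q' - L] by the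
    oscillation of [g'] at 0. The value of [L] is read off by formally differentiating the equation
    at 0. *)
Lemma euler_ode_cvg k g q : euler_ode k g q ->
  (forall x, derivable g x 1) -> {for 0, continuous (derive1 g)} ->
  derive1 q r @[r --> 0^'] --> derive1 g 0 / k.+2%:R.
Proof.
move=> [cq dq ode] dg cg.
have cgx x : {for x, continuous g}.
  by apply: differentiable_continuous; apply/derivable1_diffP.
have derg x : is_derive x 1 g (derive1 g x) by split; rewrite ?derive1E.
pose L : R := derive1 g 0 / k.+2%:R.
pose M := fun r => r ^+ k.+1 * (g r - k.+1%:R * q r) - L * r ^+ k.+2.
have dM r : r != 0 -> is_derive r 1 M (r ^+ k.+1 * (derive1 g r - derive1 g 0)).
  move=> r0; have derq : is_derive r 1 q (derive1 q r).
    by split; [exact: dq|rewrite derive1E].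
  have D := is_derive_funB
    (is_derive_funM (is_derive_funX r k)
      (is_derive_funB (derg r) (is_derive_funM (is_derive_cst (k.+1%:R : R) r 1) derq)))
    (is_derive_funM (is_derive_cst L r 1) (is_derive_funX r k.+1)).
  apply: (is_derive_eq D); rewrite /cst /L !mul0r !add0r.
  have o := ode r r0.
  have -> : derive1 g 0 / k.+2%:R * (k.+2%:R * r ^+ k.+1) = derive1 g 0 * r ^+ k.+1.
    by rewrite mulrA divfK // pnatr_eq0.
  rewrite -o exprS.
  set d := derive1 q r. ring.
have cM : {for 0, continuous M}.
  apply: cvgB; apply: cvgM; try exact: exprn_continuous; last exact: cvg_cst.
  by apply: cvgB; [exact: cgx|apply: cvgM; [exact: cvg_cst|exact: cq]].
apply/cvgrPdist_le => e e0.
have /cvgrPdist_le/(_ e e0)/nbhs_ballP[d /= d0 cgd] := cg.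
near=> r.
have r0 : r != 0 by near: r; exact: nbhs_dnbhs_neq.
have rd : `|r| < d by near: r; exact: dnbhs0_lt.
have [|c [c0 cr E]] := MVT_at0 cM _ r0.
  by move=> x x0; have [] := dM x x0.
have := cgd c; rewrite /ball /= sub0r normrN => /(_ (le_lt_trans cr rd)).
rewrite distrC => gc.
have Dc : derive1 M c = c ^+ k.+1 * (derive1 g c - derive1 g 0).
  by rewrite derive1E; case: (dM c c0).
have M0 : M 0 = 0 by rewrite /M !expr0n /= mul0r mulr0 subr0.
have ME : M r = r ^+ k.+2 * (derive1 q r - L).
  by rewrite /M -ode // (exprS r k.+1); ring.
move: E; rewrite M0 subr0 ME Dc => E.
rewrite distrC -(@ler_pM2l _ (`|r| ^+ k.+2)) ?exprn_gt0 ?normr_gt0 //.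
rewrite -{1}normrX -normrM E !normrM normrX mulrAC ler_pM ?mulr_ge0 ?exprn_ge0 //.
by rewrite [leRHS]exprSr ler_wpM2r // lerXn2r // nnegrE.
Unshelve. all: by end_near. Qed.

Lemma euler_ode_derive k g q : euler_ode k g q ->
  (forall x, derivable g x 1) -> {for 0, continuous (derive1 g)} ->
  (forall x, derivable q x 1) /\ euler_ode k.+1 (derive1 g) (derive1 q).
Proof.
move=> eq_q dg cg; have cvq := euler_ode_cvg eq_q dg cg.
have [cq dq ode] := eq_q.
pose L : R := derive1 g 0 / k.+2%:R.
(* By the mean value theorem, a limit of [q'] at 0 is also the derivative of [q] at 0. *)
have dq0 : is_derive (0 : R) 1 q L.
  have H : (fun h => h^-1 *: ((q \o shift 0) (h *: 1) - q 0)) @ 0^' --> L.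
    apply/cvgrPdist_le => e e0.
    move/cvgrPdist_le : cvq => /(_ e e0) /nbhs_ballP[d /= d0 qd].
    near=> h.
    have h0 : h != 0 by near: h; exact: nbhs_dnbhs_neq.
    have hd : `|h| < d by near: h; exact: dnbhs0_lt.
    have [c [c0 ch E]] := MVT_at0 cq dq h0.
    rewrite /= addr0 [h *: 1]mulr1 E /GRing.scale /= mulrC mulfK //.
    by apply: qd => //; rewrite /ball /= sub0r normrN (le_lt_trans ch).
  split; first by apply/cvg_ex; exists L.
  exact: cvg_lim H.
have q0 : derive1 q 0 = L by rewrite derive1E; case: dq0.
have near0 r : r != 0 -> \forall x \near r, x != 0.
  move=> r0; apply: (@near_open _ _ _ [set x | x != 0]) => //.
have derg x : is_derive x 1 g (derive1 g x) by split; rewrite ?derive1E.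
have dq1 r : r != 0 -> is_derive r 1 (derive1 q)
    ((derive1 g r - k.+2%:R * derive1 q r) / r).
  move=> r0; have derq : is_derive r 1 q (derive1 q r).
    by split; [exact: dq|rewrite derive1E].
  apply: (@near_eq_is_derive _ _ _ (fun x => x^-1 * (g x - k.+1%:R * q x))).
    near=> x; have x0 : x != 0 by near: x; exact: near0.
    by rewrite -ode // mulKf.
  have D := is_derive_funM (is_derive_funV r0 (is_derive_id r 1))
    (is_derive_funB (derg r) (is_derive_funM (is_derive_cst (k.+1%:R : R) r 1) derq)).
  apply: (is_derive_eq D); rewrite /cst /id mul0r add0r -ode //.
  rewrite -exprVn -(natr1 k.+1); set d := derive1 q r; set c := k.+1%:R.
  by field.
split.
  by move=> x; have [->|x0] := eqVneq x 0; [case: dq0|exact: dq].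
split.
- apply/continuous_withinNx; rewrite q0; exact: cvq.
- by move=> r r0; case: (dq1 r r0).
- move=> r r0; have [_] := dq1 r r0; rewrite -derive1E => ->.
  by rewrite mulrC divfK.
Unshelve. all: by end_near. Qed.

End OneVariable.

Section EvenFunctions.
Context {R : realType}.
Implicit Types (f g q phi : R -> R) (r x : R).

Definition smooth f := forall n, Ck n setT f.

Lemma smooth_derive1 f : smooth f -> smooth (derive1 f).
Proof. by move=> Cf n; apply: Ck_derive1. Qed.

Lemma smooth_derivable f : smooth f -> forall x, derivable f x 1.
Proof. by move=> /(_ 1%N) Cf x; exact: Ck_derivable Cf. Qed.

Lemma smooth_is_derive f : smooth f -> forall x, is_derive x 1 f (derive1 f x).
Proof.
by move=> Cf x; split; [exact: smooth_derivable|rewrite derive1E].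
Qed.

Lemma smooth_continuous f : smooth f -> forall x, {for x, continuous f}.
Proof. by move=> /(_ 1%N) Cf x; exact: Ck_continuous_at Cf _. Qed.

(** [q'] solves the equation of index [k.+1] with right-hand side [g'], so the induction runs over
    all [k] at once. This removes the singularity without Taylor expansions. *)
Lemma euler_ode_smooth k g q : smooth g -> euler_ode k g q -> smooth q.
Proof.
move=> Cg eq_q n; elim: n k g q Cg eq_q => // n IHn k g q Cg eq_q.
have [|dq eq_dq] := euler_ode_derive eq_q (@smooth_derivable g Cg).
  exact/smooth_continuous/smooth_derive1.
apply: Ck_line => //; apply: IHn eq_dq; exact: smooth_derive1.
Qed.

Definition quot_id f r := if r == 0 then derive1 f 0 else f r / r.

Lemma quot_idK f r : f 0 = 0 -> r * quot_id f r = f r.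
Proof.
move=> f0; rewrite /quot_id; have [->|r0] := eqVneq r 0; first by rewrite mul0r.
by rewrite mulrC divfK.
Qed.

Lemma smooth_quot_id f : smooth f -> f 0 = 0 -> smooth (quot_id f).
Proof.
move=> Cf f0; apply: (@euler_ode_smooth 0 (derive1 f)).
  exact: smooth_derive1.
have dq r : r != 0 -> is_derive r 1 (quot_id f) ((derive1 f r - quot_id f r) / r).
  move=> r0; have derf := smooth_is_derive Cf r.
  apply: (@near_eq_is_derive _ _ _ (fun x => f x * x^-1)).
    apply: (@near_open _ _ _ [set x | x != 0]) => // x /= x0.
    by rewrite /quot_id (negPf x0).
  have D := is_derive_funM derf (is_derive_funV r0 (is_derive_id r 1)).
  apply: (is_derive_eq D); rewrite /quot_id (negPf r0) /id; set d := derive1 f r.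
  by field.
split.
- apply/continuous_withinNx; rewrite {2}/quot_id eqxx.
  have [/cvg_ex[l fl] E] := smooth_is_derive Cf 0.
  rewrite -E (_ : 'D_1 f 0 = l); last exact: cvg_lim fl.
  apply: cvg_trans fl; apply: near_eq_cvg; near=> h.
  have h0 : h != 0 by near: h; exact: nbhs_dnbhs_neq.
  by rewrite /quot_id (negPf h0) /= addr0 f0 subr0 [h *: 1]mulr1 mulrC.
- by move=> r r0; have [] := dq r r0.
- move=> r r0; have [_] := dq r r0; rewrite -derive1E => ->.
  by rewrite mul1r mulrC divfK.
Unshelve. all: by end_near. Qed.

Definition even_fun phi := forall r, phi (- r) = phi r.
Definition odd_fun f := forall r, f (- r) = - f r.

Lemma derive1_opp f r : derivable f (- r) 1 ->
  derive1 (fun x => f (- x)) r = - derive1 f (- r).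
Proof.
move=> df; have -> : (fun x => f (- x)) = f \o (-%R) by [].
have dN : derivable (-%R : R -> R) r 1 by exact: derivable_opp.
rewrite (derive1_comp dN df).
by rewrite derive1N // derive1_id mulrN1.
Qed.

Lemma odd_derive1 phi : smooth phi -> even_fun phi -> odd_fun (derive1 phi).
Proof.
move=> Cp ep r; have := derive1_opp (@smooth_derivable phi Cp (- r)).
rewrite (_ : (fun x => phi (- x)) = phi); last by rewrite funeqE.
by move=> ->; rewrite opprK.
Qed.

Lemma odd0 f : odd_fun f -> f 0 = 0.
Proof. by move=> /(_ 0); rewrite oppr0 => /eqP; rewrite -addr_eq0 -mulr2n mulrn_eq0 /= => /eqP. Qed.

Lemma even_quot_id f : odd_fun f -> even_fun (quot_id f).
Proof.
move=> of_ r; rewrite /quot_id oppr_eq0; case: ifP => // r0.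
by rewrite of_ invrN mulrNN.
Qed.

(* phi' / r, that is twice the derivative of phi with respect to r ^ 2 *)
Definition dsq phi := quot_id (derive1 phi).

Lemma smooth_dsq phi : smooth phi -> even_fun phi -> smooth (dsq phi).
Proof.
move=> Cp ep; apply: smooth_quot_id; first exact: smooth_derive1.
exact/odd0/odd_derive1.
Qed.

Lemma even_dsq phi : smooth phi -> even_fun phi -> even_fun (dsq phi).
Proof. by move=> Cp ep; apply/even_quot_id/odd_derive1. Qed.

(** The mean value theorem in the variable [r ^ 2]: Rolle's theorem for [phi - K r ^ 2], with [K]
    chosen to equate the end values. Bounding the distance of [c] to both ends keeps the statement
    symmetric in [a] and [b]. *)
Lemma dsq_mean phi a b : smooth phi -> even_fun phi -> 0 <= a -> 0 <= b -> a != b ->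
  exists c, [/\ `|c - a| <= `|b - a|, `|c - b| <= `|b - a| &
    phi b - phi a = 2^-1 * dsq phi c * (b ^+ 2 - a ^+ 2)].
Proof.
move=> Cp ep.
wlog : a b / a < b => [H a0 b0|ab a0 b0 _].
  have [ab _|ba _|//] := ltgtP a b; first by apply: H; rewrite ?lt_eqF.
  have [//||//||c [ca cb E]] := H b a; rewrite ?lt_eqF //.
  exists c; rewrite distrC (distrC b a); split=> //; first by rewrite distrC.
  by rewrite -opprB E -mulrN opprB.
have ba2 : b ^+ 2 - a ^+ 2 != 0.
  by rewrite subr_eq0 eqf_sqr negb_or; apply/andP; split; apply/eqP; lra.
pose K := (phi b - phi a) / (b ^+ 2 - a ^+ 2).
pose psi := fun r => phi r - K * r ^+ 2.
have dpsi r : is_derive r 1 psi (derive1 phi r - 2 * K * r).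
  have D := is_derive_funB (smooth_is_derive Cp r)
     (is_derive_funM (is_derive_cst K r 1) (is_derive_funX r 1)).
  by apply: (is_derive_eq D); rewrite /cst; ring.
have [|||c cab [_]] := Rolle ab (f := psi).
- by move=> x _; case: (dpsi x).
- apply: within_continuousT => x; apply: differentiable_continuous.
  by apply/derivable1_diffP; case: (dpsi x).
- by rewrite /psi /K; field.
have [_ ->] := dpsi c => E.
have c0 : c != 0 by rewrite gt_eqF // (le_lt_trans a0) // (itvP cab).
have dE : dsq phi c = 2 * K.
  rewrite /dsq /quot_id (negPf c0); have -> : derive1 phi c = 2 * K * c by lra.
  by rewrite mulfK.
have [ac cb] : a < c /\ c < b by rewrite !(itvP cab).
exists c; rewrite (@gtr0_norm _ (c - a)) ?subr_gt0 //.
rewrite (@ltr0_norm _ (c - b)) ?subr_lt0 // (@gtr0_norm _ (b - a)) ?subr_gt0 //.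
split; [lra|lra|].
by rewrite dE mulKf ?pnatr_eq0 // /K divfK.
Qed.

End EvenFunctions.

(** * Smooth even functions of a square root *)

Section RadialComposition.
Context {R : realType} {V : normedModType R}.
Implicit Types (phi : R -> R) (P : V -> R).

(** The slope of [phi (sqrt P)] against [P] is half of [dsq phi] at an intermediate radius, hence
    continuous at [x]. No case distinction on [P x = 0] arises. *)
Lemma is_diff_radial phi P x : smooth phi -> even_fun phi ->
  (forall y, 0 <= P y) -> differentiable P x ->
  is_diff x (fun y => phi (Num.sqrt (P y)))
            (fun v => 2^-1 * dsq phi (Num.sqrt (P x)) * 'd P x v).
Proof.
move=> Cp ep P0 dP.
pose s y := Num.sqrt (P y).
have s2 y : s y ^+ 2 = P y by rewrite sqr_sqrtr.
pose c y := if P y == P x then 2^-1 * dsq phi (s x)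
            else (phi (s y) - phi (s x)) / (P y - P x).
have cx : c x = 2^-1 * dsq phi (s x) by rewrite /c eqxx.
rewrite -[2^-1 * _]cx; apply: (is_diff_slope (P := P) (c := c)) => //.
  near=> y; rewrite /c; have [E|PyPx] := eqVneq (P y) (P x).
    by rewrite /s E !subrr mulr0.
  by rewrite divfK // subr_eq0.
have cs : {for x, continuous s}.
  apply: continuous_comp; last exact: sqrt_continuous.
  exact: differentiable_continuous.
apply/cvgrPdist_le => e e0; rewrite cx.
have /cvgrPdist_le/(_ e e0)/nbhs_ballP[d /= d0 cd] :=
  @smooth_continuous _ _ (smooth_dsq Cp ep) (s x).
near=> y; rewrite /c; case: eqVneq => [_|PyPx]; first by rewrite subrr normr0 ltW.
have sxy : s x != s y by apply: contra_neq PyPx => E; rewrite -!s2 E.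
have [k [kx _ E]] := dsq_mean Cp ep (sqrtr_ge0 (P x)) (sqrtr_ge0 (P y)) sxy.
rewrite [phi (s y) - _]E !s2 mulfK ?subr_eq0 // -mulrBr normrM.
have kd : `|dsq phi (s x) - dsq phi k| <= e.
  apply: cd; rewrite /ball /= distrC (le_lt_trans kx) // distrC.
  by near: y; move/cvgrPdist_lt: cs; exact.
rewrite (le_trans _ kd) // ler_piMl // ger0_norm ?invr_ge0 //.
by rewrite invf_le1 // ler1n.
Unshelve. all: by end_near. Qed.

(** The derivative is [dsq phi (sqrt P)] times a smooth factor, and [dsq phi] is again smooth and
    even: the class reproduces itself. *)
Lemma Ck_radial n U phi P : open U -> smooth phi -> even_fun phi ->
  (forall y, 0 <= P y) -> (forall n, Ck n U P) ->
  Ck n U (fun y => phi (Num.sqrt (P y))).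
Proof.
move=> oU + + P0 CP; elim: n phi => // n IHn phi Cp ep.
have D x : U x -> is_diff x (fun y => phi (Num.sqrt (P y)))
            (fun v => 2^-1 * dsq phi (Num.sqrt (P x)) * 'd P x v).
  by move=> Ux; apply: is_diff_radial => //; exact: (CP 1%N).1.
split=> [x Ux|v]; first by case: (D x Ux).
have C1 := IHn _ (smooth_dsq Cp ep) (even_dsq Cp ep).
have C2 := (CP n.+1).2 v.
apply: Ck_eq (Ck_mul oU (Ck_mul (f := fun=> 2^-1) oU (Ck_cst _ _ _) C1) C2) => //.
move=> x Ux; have [d1 d2] := D x Ux.
by rewrite [RHS]deriveE // d2 deriveE //; exact: (CP 1%N).1.
Qed.

End RadialComposition.

Section LastZero.
Context {R : realType}.

(** The supremum of the points where [f] is nonnegative. It serves twice: for the sign of [t], and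
    to start a Gronwall argument where two geodesics separate. *)
Lemma last_zero (f : R -> R) (a b : R) : a <= b ->
  (forall u, a <= u <= b -> {for u, continuous f}) -> 0 <= f a -> f b < 0 ->
  exists rho, [/\ a <= rho < b, f rho = 0 & forall u, rho < u <= b -> f u < 0].
Proof.
move=> ab cf fa fb.
pose S := [set u | a <= u <= b /\ 0 <= f u].
have Sa : S a by split=> //; rewrite lexx.
have bS : has_ubound S by exists b => u [/andP[]].
have hS : has_sup S by split=> //; exists a.
pose rho := sup S.
have arho : a <= rho by exact: ub_le_sup.
have rhob : rho <= b by apply: ge_sup => [|u [/andP[]]//]; exists a.
have ab_rho : a <= rho <= b by rewrite arho.
have ball_rho (P : R -> Prop) : (\forall u \near rho, P u) ->
    exists2 d, 0 < d & forall u, `|rho - u| < d -> P u.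
  by move=> /nbhs_ballP[d /= d0 dP]; exists d.
have frho : 0 <= f rho.
  rewrite leNgt; apply/negP => f0.
  have [d d0 dP] : exists2 d, 0 < d & forall u, `|rho - u| < d -> f u < 0.
    apply: ball_rho; have := cf _ ab_rho; move/cvgrPdist_lt => /(_ (- f rho)).
    rewrite oppr_gt0 => /(_ f0); apply: filterS => u.
    by rewrite ltr_norml opprK ltrDl oppr_gt0 => /andP[].
  have [u Su ud] := sup_adherent d0 hS; have [_ fu] := Su.
  have urho : u <= rho by exact: ub_le_sup.
  have {}ud : rho - d < u by [].
  have /dP : `|rho - u| < d by rewrite ger0_norm ?subr_ge0 //; lra.
  by rewrite ltNge fu.
have lt_rhob : rho < b.
  by rewrite lt_neqAle rhob andbT; apply: contraTneq frho => ->; rewrite -ltNge.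
have neg u : rho < u <= b -> f u < 0.
  move=> /andP[ru ub]; rewrite ltNge; apply/negP => fu.
  suff : u <= rho by rewrite leNgt ru.
  by apply: ub_le_sup => //; split=> //; rewrite ub (le_trans arho) // ltW.
exists rho; split=> //; first by rewrite arho.
apply/eqP; rewrite eq_le frho andbT leNgt; apply/negP => f0.
have [d d0 dP] : exists2 d, 0 < d & forall u, `|rho - u| < d -> 0 < f u.
  apply: ball_rho; have := cf _ ab_rho; move/cvgrPdist_lt => /(_ _ f0).
  by apply: filterS => u; rewrite ltr_norml ltrBlDr ltrDl => /andP[].
pose u := Num.min (rho + d / 2) b.
have ru : rho < u by rewrite lt_min lt_rhob andbT ltrDl divr_gt0.
have ub : u <= b by rewrite ge_min lexx orbT.
have ud : u <= rho + d / 2 by rewrite ge_min lexx.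
have /dP : `|rho - u| < d by rewrite distrC gtr0_norm ?subr_gt0 //; lra.
by rewrite ltNge ltW // neg // ru.
Qed.

End LastZero.

(** * Reflecting one-sided solutions across 0 *)

Section Reflection.
Context {R : realType}.

(** The sign [sg] covers odd and even extensions together; the derivative has the opposite parity,
    whence [- sg]. At 0 a left difference quotient is [- sg] times a right one, so both one-sided
    limits agree. *)
Lemma is_derive_reflect (sg : R) (f F l : R -> R) : sg ^+ 2 = 1 ->
  (forall u, 0 <= u -> F u = f u) -> (forall u, F (- u) = sg * F u) ->
  (forall u, l (- u) = - sg * l u) ->
  (forall r, 0 <= r -> has_deriv_ge0 f r (l r)) ->
  forall r : R, is_derive r (1 : R) F (l r).
Proof.
move=> sg2 Ff Fsg lsg df.
have sg1 : `|sg| = 1.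
  by apply/eqP; rewrite -sqr_norm_eq1 sg2.
have main (r : R) : 0 <= r -> is_derive r (1 : R) F (l r).
  move=> r0; have /cvgrPdist_le dfr := df r r0.
  suff H : (fun h => h^-1 *: ((F \o shift r) (h *: 1) - F r)) @ 0^' --> l r.
    by split; [apply/cvg_ex; exists (l r)|exact: cvg_lim H].
  apply/cvgrPdist_le => e e0.
  have /nbhs_ballP[d /= d0 dP] := dfr e e0.
  have dQ u : `|r - u| < d -> u != r -> 0 <= u ->
      `|l r - (F u - F r) / (u - r)| <= e.
    by move=> ud ur u0; rewrite !Ff //; apply: dP.
  have rr : r = 0 \/ 0 < r by move: r0; rewrite le_eqVlt => /orP[/eqP<-|]; [left|right].
  (* For [r > 0] the radius is capped by [r], so that [h + r] stays where the one-sided hypothesis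
     speaks. Only at [r = 0] can [h + r] be negative. *)
  pose d' := if r == 0 then d else Num.min d r.
  have d'0 : 0 < d'.
    by rewrite /d'; case: rr => [->|r1]; rewrite ?eqxx // gt_eqF // lt_min d0.
  have d'd : d' <= d by rewrite /d'; case: ifP => //; rewrite ge_min lexx.
  near=> h.
  have h0 : h != 0 by near: h; exact: nbhs_dnbhs_neq.
  have hd : `|h| < d' by near: h; exact: dnbhs0_lt.
  have hdd : `|h| < d by exact: lt_le_trans hd d'd.
  rewrite /= [h *: 1]mulr1 [_ *: _]mulrC.
  have E : h = h + r - r by rewrite addrK.
  have hr : h + r != r by rewrite -subr_eq0 addrK.
  have [hr0|hr0] := leP 0 (h + r).
    rewrite [X in _ / X]E; apply: dQ => //.
    by rewrite opprD addrCA subrr addr0 normrN.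
  have r0' : r = 0.
    case: rr => // r1; move: hd; rewrite /d' gt_eqF // lt_min => /andP[_].
    by rewrite ltr_norml => /andP[? ?]; lra.
  rewrite r0' addr0 in hr0 *.
  have lN : l 0 = - sg * l 0 by have := lsg 0; rewrite oppr0.
  have F0 : F 0 = sg * F 0 by have := Fsg 0; rewrite oppr0.
  have Fh : F h = sg * F (- h) by have := Fsg (- h); rewrite opprK.
  have -> : l 0 - (F h - F 0) / h = - sg * (l 0 - (F (- h) - F 0) / (- h)).
    by rewrite mulrBr -lN Fh {1}F0 invrN; ring.
  rewrite normrM normrN sg1 mul1r.
  have := dQ (- h); rewrite r0' subr0 sub0r opprK oppr_eq0 oppr_ge0.
  by apply => //; exact: ltW.
move=> r; have [r0|r0] := leP 0 r; first exact: main.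
have r1 : 0 <= - r by rewrite oppr_ge0 ltW.
have FE : F = fun x => sg * F (- x) by rewrite funeqE => x; rewrite -Fsg opprK.
have D := main _ r1.
have DN : is_derive r 1 (fun x => F (- x)) (- l (- r)).
  have dF : derivable F (- r) 1 by case: D.
  have dN : derivable (-%R : R -> R) r 1 by exact: derivable_opp.
  have dFN : derivable (fun x => F (- x)) r 1.
    apply/derivable1_diffP; apply: (differentiable_comp (f := -%R)).
      exact/derivable1_diffP.
    exact/derivable1_diffP.
  split=> //; rewrite -derive1E derive1_opp //; congr (- _).
  by rewrite derive1E; case: D.
rewrite FE; apply: (is_derive_eq (is_derive_funM (is_derive_cst sg r 1) DN)).
by rewrite lsg /cst mul0r add0r mulNr opprK mulrA -expr2 sg2 mul1r.
Unshelve. all: by end_near. Qed.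

End Reflection.

(** * The profile functions *)

Section SquareQuotient.
Context {R : realType}.
Implicit Type phi : R -> R.

Definition quot_sq phi := quot_id (quot_id phi).

Lemma even_derive1_0 phi : smooth phi -> even_fun phi -> derive1 phi 0 = 0.
Proof. by move=> Cp ep; exact/odd0/odd_derive1. Qed.

Lemma quot_id_0 phi : quot_id phi 0 = derive1 phi 0.
Proof. by rewrite /quot_id eqxx. Qed.

Lemma smooth_quot_sq phi : smooth phi -> even_fun phi -> phi 0 = 0 ->
  smooth (quot_sq phi).
Proof.
move=> Cp ep p0; apply: smooth_quot_id; first exact: smooth_quot_id.
by rewrite quot_id_0 even_derive1_0.
Qed.

Lemma even_quot_sq phi : smooth phi -> even_fun phi -> even_fun (quot_sq phi).
Proof.
move=> Cp ep; apply: even_quot_id => r; rewrite /quot_id oppr_eq0.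
case: ifP => [_|r0]; first by rewrite even_derive1_0 // oppr0.
by rewrite ep invrN mulrN.
Qed.

Lemma quot_sqK phi r : smooth phi -> even_fun phi -> phi 0 = 0 ->
  r ^+ 2 * quot_sq phi r = phi r.
Proof.
move=> Cp ep p0; rewrite expr2 -mulrA quot_idK ?quot_idK //.
by rewrite quot_id_0 even_derive1_0.
Qed.

Lemma quot_sq_0 phi : smooth phi -> even_fun phi -> phi 0 = 0 ->
  quot_sq phi 0 = 2^-1 * derive1 (derive1 phi) 0.
Proof.
move=> Cp ep p0; rewrite /quot_sq quot_id_0.
have Cq := smooth_quot_id Cp p0; set q := quot_id phi in Cq *.
have E : derive1 phi = fun r => q r + r * derive1 q r.
  rewrite funeqE => r.
  have -> : phi = fun r => r * q r by rewrite funeqE => u; rewrite quot_idK.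
  have [_ Dq] := is_derive_funM (is_derive_id r 1) (smooth_is_derive Cq r).
  by rewrite [LHS]derive1E Dq mul1r.
have [_ Dq] := is_derive_funD (smooth_is_derive Cq 0)
  (is_derive_funM (is_derive_id (0 : R) 1) (smooth_is_derive (smooth_derive1 Cq) 0)).
rewrite E [X in _ * X]derive1E Dq /id mul1r mul0r addr0.
by set d := derive1 q 0; field.
Qed.

End SquareQuotient.

(* A smooth even function of r = |v| is smooth in v, also at v = 0. *)
Record profile_quotients {R : realType} (t nu theta N iota chi : R -> R) : Prop :=
  ProfileQuotients {
  theta_smooth : smooth theta;
  theta_even : even_fun theta;
  N_smooth : smooth N;
  N_even : even_fun N;
  iota_smooth : smooth iota;
  iota_even : even_fun iota;
  chi_smooth : smooth chi;
  chi_even : even_fun chi;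
  t_theta : forall r, 0 <= r -> t r = r * theta r;
  nu_N : forall r, 0 <= r -> nu r ^+ 2 = N r;
  int0_iota : forall r, 0 <= r -> 2 * int0 t r = r ^+ 2 * iota r;
  theta_chi : forall r, 1 - theta r ^+ 2 = r ^+ 2 * chi r;
  theta_gt0 : forall r, 0 < theta r;
  theta_le1 : forall r, theta r <= 1;
  theta_0 : theta 0 = 1;
  N_gt0 : forall r, 0 < N r;
  iota_gt0 : forall r, 0 < iota r;
  iota_0 : iota 0 = 1
}.

Section Profile.
Context {R : realType} (nu0 : R) (t nu : R -> R).
Hypotheses (nu0_gt0 : 0 < nu0) (tnu : profile nu0 t nu).

(** The extensions of [t] and [nu ^ 2] by parity. The square of [nu] is kept as the unknown because
    the system involves [nu] only through it. *)
Let T (r : R) : R := if 0 <= r then t r else - t (- r).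
Let N (r : R) : R := nu `|r| ^+ 2.

Let T0 : T 0 = 0.
Proof. by rewrite /T lexx; case: tnu. Qed.

Let oddT : odd_fun T.
Proof.
move=> r; rewrite /T oppr_ge0; have [r0|r0|->] := ltgtP r 0.
- by rewrite opprK.
- by rewrite opprK.
- by rewrite oppr0; case: tnu => ->; rewrite oppr0.
Qed.

Let evenN : even_fun N.
Proof. by move=> r; rewrite /N normrN. Qed.

Let derT (r : R) : is_derive r (1 : R) T (1 - 2 * T r ^+ 2 / N r).
Proof.
apply: (@is_derive_reflect R (-1) t T (fun r => 1 - 2 * T r ^+ 2 / N r)).
- by rewrite sqrrN expr1n.
- by move=> u u0; rewrite /T u0.
- by move=> u; rewrite oddT mulN1r.
- by move=> u; rewrite oddT evenN sqrrN opprK mul1r.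
- by move=> u u0; rewrite /N /T u0 ger0_norm //; have [_ _ /(_ _ u0)[]] := tnu.
Qed.

Let derN (r : R) : is_derive r (1 : R) N (6 * T r).
Proof.
apply: (@is_derive_reflect R 1 (fun u => nu u ^+ 2) N (fun r => 6 * T r)).
- by rewrite expr1n.
- by move=> u u0; rewrite /N ger0_norm.
- by move=> u; rewrite evenN mul1r.
- by move=> u; rewrite oddT mulN1r mulrN.
- by move=> u u0; rewrite /T u0; have [_ _ /(_ _ u0)[]] := tnu.
Qed.

Let is_derive_cont (f df : R -> R) : (forall r : R, is_derive r (1 : R) f (df r)) ->
  forall r, {for r, continuous f}.
Proof.
move=> D r; apply: differentiable_continuous; apply/derivable1_diffP.
by case: (D r).
Qed.

(** At a zero of [T] the equation gives slope 1, so [T] is positive just after it, and no last zero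
    can precede a negative value. The term [T ^ 2 / N] vanishes there whatever [N] is, so positivity
    of [N] may be deduced afterwards. *)
Let T_ge0 r : 0 <= r -> 0 <= T r.
Proof.
move=> r0; rewrite leNgt; apply/negP => Tr.
have [rho [/andP[rho0 rhor] Trho neg]] :=
  last_zero r0 (fun u _ => is_derive_cont derT (r := u)) (ltac:(by rewrite T0)) Tr.
have [dT] := derT rho; rewrite Trho expr0n mulr0 mul0r subr0 => ET.
have cv : (fun h => h^-1 *: ((T \o shift rho) (h *: 1) - T rho)) @ 0^' --> 'D_1 T rho.
  exact: dT.
rewrite ET in cv.
move/cvgrPdist_lt/(_ _ ltr01)/nbhs_ballP : cv => [d /= d0 dP].
pose h := Num.min (d / 2) (r - rho).
have h0 : 0 < h by rewrite lt_min subr_gt0 rhor divr_gt0.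
have hd : h < d by rewrite gt_min ltr_pdivrMr // mulr_natr mulr2n ltrDl d0.
have hr : h <= r - rho by rewrite ge_min lexx orbT.
have := dP h; rewrite /ball /= sub0r normrN gtr0_norm // => /(_ hd).
rewrite gt_eqF // => /(_ isT); rewrite [h *: 1]mulr1 Trho subr0.
rewrite ltr_norml => /andP[_]; rewrite ltrBlDr ltrDl.
rewrite [_ *: _]mulrC pmulr_lgt0 ?invr_gt0 // ltNge ltW //.
have hh : rho < h + rho <= r by rewrite ltrDr h0 -lerBrDr.
exact: (neg _ hh).
Qed.

Let MVT0 (f df : R -> R) r : (forall r : R, is_derive r (1 : R) f (df r)) ->
  0 < r -> exists2 c, 0 < c & f r - f 0 = df c * r.
Proof.
move=> D r0; have [|c cr E] := MVT r0 (fun x _ => D x).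
  by apply: within_continuousT; exact: is_derive_cont D.
by exists c; [rewrite (itvP cr)|rewrite E subr0].
Qed.

Let N0 : N 0 = nu0 ^+ 2.
Proof. by rewrite /N normr0; case: tnu => _ ->. Qed.

Let N_gt0 r : 0 < N r.
Proof.
wlog : r / 0 <= r => [H|].
  by have [/H//|r0] := leP 0 r; rewrite -evenN H // oppr_ge0 ltW.
rewrite le_eqVlt => /orP[/eqP<-|r0]; first by rewrite N0 exprn_gt0.
have [c c0 E] := MVT0 derN r0.
rewrite -(subrK (N 0) (N r)) E ltr_wpDl ?N0 ?exprn_gt0 //.
by rewrite !mulr_ge0 ?T_ge0 ?ltW.
Qed.

(** A zero at [r > 0] would be an interior minimum of a nonnegative function, with derivative 0
    instead of the 1 given by the equation. *)
Let T_gt0 r : 0 < r -> 0 < T r.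
Proof.
move=> r0; rewrite lt_neqAle T_ge0 ?andbT ?ltW //; apply/eqP => Tr.
have Dm : is_derive r 1 T 0.
  apply: (@derive1_at_min _ T 0 (r + 1)); first by lra.
  - by move=> u _; case: (derT u).
  - by rewrite in_itv /= r0 ltrDl ltr01.
  - by move=> u; rewrite -Tr => /itvP ur; rewrite T_ge0 // ltW // ur.
have [_] := Dm; have [_ ->] := derT r.
by rewrite -Tr expr0n mulr0 mul0r subr0 => /eqP; rewrite oner_eq0.
Qed.

(** Bootstrap: since [N] never vanishes, the right-hand sides of the system are as regular as [T]
    and [N], which gains one derivative. *)
Let CTN n : Ck n setT T /\ Ck n setT N.
Proof.
elim: n => // n [CT CN].
have oT := @openT R; have NV := Ck_inv oT (fun x _ => lt0r_neq0 (N_gt0 x)) CN.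
have C2 c : Ck n setT (fun _ : R => c : R) by exact: Ck_cst.
split; apply: Ck_line => [x|].
- by case: (derT x).
- apply: Ck_eq (Ck_add oT (C2 1) (Ck_mul oT (C2 (- 2)) (Ck_mul oT (Ck_exp 2 oT CT) NV))) => // x _.
  by rewrite derive1E; have [_ ->] := derT x; rewrite mulNr mulrA.
- by case: (derN x).
- apply: Ck_eq (Ck_mul oT (C2 6) CT) => // x _.
  by rewrite derive1E; have [_ ->] := derN x.
Qed.

Lemma profile_quotientsP :
  exists theta N iota chi, profile_quotients t nu theta N iota chi.
Proof.
have oT := @openT R.
have CT : smooth T by move=> n; case: (CTN n).
have CN : smooth N by move=> n; case: (CTN n).
have Cc c : smooth (fun _ : R => c : R) by move=> n; exact: Ck_cst.
have T1 : derive1 T 0 = 1.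
  by rewrite derive1E; have [_ ->] := derT 0; rewrite T0 expr0n mulr0 mul0r subr0.
pose theta := quot_id T.
have Ctheta : smooth theta by exact: smooth_quot_id.
have etheta : even_fun theta by exact: even_quot_id.
have theta0 : theta 0 = 1 by rewrite /theta quot_id_0.
have theta_pos r : 0 < r -> 0 < theta r.
  by move=> r0; rewrite /theta /quot_id gt_eqF // divr_gt0 // T_gt0.
(* [T r / r] is a value of [T'] by the mean value theorem, and [T' = 1 - 2 T ^ 2 / N <= 1]. *)
have theta_1 r : 0 < r -> theta r <= 1.
  move=> r0; rewrite /theta /quot_id gt_eqF // ler_pdivrMr // mul1r.
  have [c c0] := MVT0 derT r0; rewrite T0 subr0 => ->.
  rewrite ler_piMl ?(ltW r0) // lerBlDr lerDl.
  by rewrite mulr_ge0 ?invr_ge0 ?(ltW (N_gt0 c)) // mulr_ge0 ?sqr_ge0.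
have sgn (P : R -> Prop) (phi : R -> R) : even_fun phi -> P (phi 0) ->
    (forall r, 0 < r -> P (phi r)) -> forall r, P (phi r).
  move=> ep P0 Pp r; have [r0|r0|<-//] := ltgtP 0 r; first exact: Pp.
  by rewrite -ep; apply: Pp; rewrite oppr_gt0.
pose f (r : R) : R := 1 - theta r ^+ 2.
have Cf : smooth f.
  move=> n; exact: (Ck_add oT (Cc 1 n) (Ck_opp oT (Ck_exp 2 oT (Ctheta n)))).
have ef : even_fun f by move=> r; rewrite /f etheta.
have f0 : f 0 = 0 by rewrite /f theta0 expr1n subrr.
(* As [N' = 6 T], this is the primitive of [2 T] vanishing at 0. Its regularity and parity come from
   [N]; the integral [int0] is identified with it only at the end. *)
pose J (r : R) : R := 3^-1 * (N r - nu0 ^+ 2).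
have CJ : smooth J.
  move=> n; apply: Ck_mul => //; first exact: Cc.
  exact: (Ck_add oT (CN n) (Cc (- nu0 ^+ 2) n)).
have eJ : even_fun J by move=> r; rewrite /J evenN.
have J0 : J 0 = 0 by rewrite /J N0 subrr mulr0.
have dJ : derive1 J = fun r => 2 * T r.
  rewrite funeqE => r; have [_ DJ] := is_derive_funM (is_derive_cst (3^-1 : R) r 1)
     (is_derive_funB (derN r) (is_derive_cst (nu0 ^+ 2 : R) r 1)).
  by rewrite [LHS]derive1E DJ /cst; field.
have iota0 : quot_sq J 0 = 1.
  rewrite quot_sq_0 // dJ.
  have [_ DT] := is_derive_funM (is_derive_cst (2 : R) (0 : R) 1) (derT 0).
  rewrite derive1E DT /cst T0 expr0n !(mulr0, mul0r).
  by rewrite add0r subr0 mulr1 mulVf // pnatr_eq0.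
exists theta, N, (quot_sq J), (quot_sq f); split => //.
- exact: smooth_quot_sq.
- exact: even_quot_sq.
- exact: smooth_quot_sq.
- exact: even_quot_sq.
- by move=> r r0; rewrite quot_idK // /T r0.
- by move=> r r0; rewrite /N ger0_norm.
- move=> r r0; rewrite quot_sqK //.
  have -> : int0 t r = 6^-1 * (N r - N 0).
    move: r0; rewrite le_eqVlt => /orP[/eqP<-|r0].
      by rewrite subrr mulr0 /int0 set_itv1 Rintegral_set1.
    transitivity (int0 T r).
      by apply: eq_Rintegral => u; rewrite inE /= => /itvP ur; rewrite /T ur.
    have cT := is_derive_cont derT.
    have D6 (u : R) : is_derive u (1 : R) (fun x => 6^-1 * N x) (T u).
      have D := is_derive_funM (is_derive_cst (6^-1 : R) u 1) (derN u).
      by apply: (is_derive_eq D); rewrite /cst mul0r add0r mulKf // pnatr_eq0.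
    rewrite /int0 /Rintegral (continuous_FTC2 (F := fun x => 6^-1 * N x)) //.
    + by rewrite /= mulrBr.
    + exact: within_continuousT.
    + split.
      * by move=> u _; case: (D6 u).
      * by apply: cvg_at_right_filter; exact: (is_derive_cont D6 (r := 0)).
      * by apply: cvg_at_left_filter; exact: (is_derive_cont D6 (r := r)).
    + by move=> u _; rewrite derive1E; case: (D6 u).
  by rewrite /J N0; field.
- by move=> r; rewrite quot_sqK.
- by apply: (sgn (fun x => 0 < x)) => //; rewrite theta0.
- by apply: (sgn (fun x => x <= 1)) => //; rewrite theta0.
- apply: (sgn (fun x => 0 < x)); rewrite ?iota0 //; first exact: even_quot_sq.
  move=> r r0; rewrite -(@pmulr_rgt0 _ (r ^+ 2)) ?exprn_gt0 //.
  rewrite quot_sqK // /J mulr_gt0 ?invr_gt0 // -N0.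
  have [c c0 ->] := MVT0 derN r0.
  by rewrite !mulr_gt0 // T_gt0.
Qed.

End Profile.

(** * Quaternions and the Maurer-Cartan form *)

Section QuaternionAlgebra.
Context {R : realType}.
Implicit Types (p q v w h : 'rV[R]_4).

Definition mkim (b c d : R) : 'rV[R]_3 := \row_(k < 3) nth 0 [:: b; c; d] k.

Lemma mkqP q : exists a b c d, q = mkq a b c d.
Proof.
exists (q 0 (inord 0)), (q 0 (inord 1)), (q 0 (inord 2)), (q 0 (inord 3)).
apply/rowP => k; rewrite mxE.
by case: k => -[|[|[|[|//]]]] kP /=; congr (q 0 _); apply: val_inj; rewrite /= inordK.
Qed.

Lemma mkimP (u : 'rV[R]_3) : exists b c d, u = mkim b c d.
Proof.
exists (u 0 (inord 0)), (u 0 (inord 1)), (u 0 (inord 2)).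
apply/rowP => k; rewrite mxE.
by case: k => -[|[|[|//]]] kP /=; congr (u 0 _); apply: val_inj; rewrite /= inordK.
Qed.

Lemma qmul_mkq a b c d a' b' c' d' :
  qmul (mkq a b c d) (mkq a' b' c' d' : 'rV[R]_4) =
  mkq (a * a' - b * b' - c * c' - d * d')
      (a * b' + b * a' + c * d' - d * c')
      (a * c' - b * d' + c * a' + d * b')
      (a * d' + b * c' - c * b' + d * a').
Proof. by rewrite /qmul /mkq !mxE !inordK. Qed.

Lemma qconj_mkq a b c d : qconj (mkq a b c d : 'rV[R]_4) = mkq a (- b) (- c) (- d).
Proof.
by apply/rowP => -[[|[|[|[|//]]]] kP]; rewrite !mxE.
Qed.

Lemma qim_mkq a b c d : qim (mkq a b c d : 'rV[R]_4) = mkim b c d.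
Proof. by apply/rowP => -[[|[|[|//]]] kP]; rewrite !mxE. Qed.

Lemma qpure_mkim b c d : qpure (mkim b c d) = mkq 0 b c d :> 'rV[R]_4.
Proof.
apply/rowP => k; rewrite !mxE; case: unliftP => [l ->|->] //=.
by case: l => -[|[|[|//]]] lP; rewrite !mxE.
Qed.

Lemma dotv_mkq a b c d a' b' c' d' :
  dotv (mkq a b c d) (mkq a' b' c' d' : 'rV[R]_4) = a * a' + b * b' + c * c' + d * d'.
Proof. by rewrite /dotv !big_ord_recr big_ord0 /= !mxE /= add0r. Qed.

Lemma dotv_mkim b c d b' c' d' :
  dotv (mkim b c d) (mkim b' c' d' : 'rV[R]_3) = b * b' + c * c' + d * d'.
Proof. by rewrite /dotv !big_ord_recr big_ord0 /= !mxE /= add0r. Qed.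

Lemma mkqD a b c d a' b' c' d' :
  mkq a b c d + mkq a' b' c' d' = mkq (a + a') (b + b') (c + c') (d + d') :> 'rV[R]_4.
Proof. by apply/rowP => -[[|[|[|[|//]]]] kP]; rewrite !mxE. Qed.

Lemma mkqZ k a b c d : k *: mkq a b c d = mkq (k * a) (k * b) (k * c) (k * d) :> 'rV[R]_4.
Proof. by apply/rowP => -[[|[|[|[|//]]]] kP]; rewrite !mxE. Qed.

Lemma mkimD b c d b' c' d' :
  mkim b c d + mkim b' c' d' = mkim (b + b') (c + c') (d + d').
Proof. by apply/rowP => -[[|[|[|//]]] kP]; rewrite !mxE. Qed.

Lemma mkimZ k b c d : k *: mkim b c d = mkim (k * b) (k * c) (k * d).
Proof. by apply/rowP => -[[|[|[|//]]] kP]; rewrite !mxE. Qed.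

(* Unification would apply the rules for mkq to the unfolding of qmul. *)
Fact qmul_key : unit. Proof. exact: tt. Qed.
Definition lqmul := locked_with qmul_key (@qmul R).
Lemma qmul_lock : qmul = lqmul. Proof. by rewrite [lqmul]unlock. Qed.

Lemma lqmul_mkq a b c d a' b' c' d' :
  lqmul (mkq a b c d) (mkq a' b' c' d') =
  mkq (a * a' - b * b' - c * c' - d * d')
      (a * b' + b * a' + c * d' - d * c')
      (a * c' - b * d' + c * a' + d * b')
      (a * d' + b * c' - c * b' + d * a').
Proof. by rewrite -qmul_lock qmul_mkq. Qed.

Definition mkqE := (lqmul_mkq, qconj_mkq, qim_mkq, qpure_mkim, dotv_mkq, dotv_mkim,
  mkqD, mkqZ, mkimD, mkimZ).

Lemma qmul_linear h : linear (qmul h).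
Proof.
move=> k p q; have [a [b [c [d ->]]]] := mkqP h.
have [a1 [b1 [c1 [d1 ->]]]] := mkqP p; have [a2 [b2 [c2 [d2 ->]]]] := mkqP q.
by rewrite qmul_lock !mkqE; congr mkq; ring.
Qed.

Lemma im_conj_mul_add v (k : R) p q :
  qim (qmul (qconj v) (k *: p + q)) =
  k *: qim (qmul (qconj v) p) + qim (qmul (qconj v) q).
Proof.
have [a [b [c [d ->]]]] := mkqP v.
have [a1 [b1 [c1 [d1 ->]]]] := mkqP p; have [a2 [b2 [c2 [d2 ->]]]] := mkqP q.
by rewrite qmul_lock !mkqE; congr mkim; ring.
Qed.

Lemma im_conj_self v (k : R) : qim (qmul (qconj v) (k *: v)) = 0.
Proof.
have [a [b [c [d ->]]]] := mkqP v; rewrite qmul_lock !mkqE.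
by apply/rowP => -[[|[|[|//]]] kP]; rewrite !mxE /=; ring.
Qed.

Lemma im_conj_scale v (k : R) q :
  qim (qmul (qconj (k *: v)) q) = k *: qim (qmul (qconj v) q).
Proof.
have [a [b [c [d ->]]]] := mkqP v; have [a1 [b1 [c1 [d1 ->]]]] := mkqP q.
by rewrite qmul_lock !mkqE; congr mkim; ring.
Qed.

Lemma im_conj_pure v (k : R) (u : 'rV[R]_3) :
  qim (qmul (qmul (qconj (k *: v)) (qpure u)) (k *: v)) =
  k ^+ 2 *: qim (qmul (qconj v) (qmul (qpure u) v)).
Proof.
have [a [b [c [d ->]]]] := mkqP v; have [b1 [c1 [d1 ->]]] := mkimP u.
by rewrite qmul_lock !mkqE; congr mkim; ring.
Qed.

(** Left multiplication by [qconj v] scales the inner product by [|v| ^ 2], and the real part of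
    [qconj v] times [p] is [<v, p>]: the imaginary parts account for the difference. *)
Lemma dotv_im_conj v p q :
  dotv (qim (qmul (qconj v) p)) (qim (qmul (qconj v) q)) =
  dotv v v * dotv p q - dotv v p * dotv v q.
Proof.
have [a [b [c [d ->]]]] := mkqP v.
have [a1 [b1 [c1 [d1 ->]]]] := mkqP p; have [a2 [b2 [c2 [d2 ->]]]] := mkqP q.
by rewrite qmul_lock !mkqE; ring.
Qed.

(** Multiplication by an imaginary quaternion is skew-symmetric: parallel transport preserves the
    radius. *)
Lemma dotv_pure_mul v (u : 'rV[R]_3) : dotv v (qmul (qpure u) v) = 0.
Proof.
have [a [b [c [d ->]]]] := mkqP v; have [b1 [c1 [d1 ->]]] := mkimP u.
by rewrite qmul_lock !mkqE; ring.
Qed.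

(** Conjugation reverses products, so [qconj h] meets [h] in the middle. For unit [h] this makes the
    bubble independent of the frame chosen at [z]. *)
Lemma im_conj_mul h p q :
  qim (qmul (qconj (qmul h p)) (qmul h q)) = dotv h h *: qim (qmul (qconj p) q).
Proof.
have [a [b [c [d ->]]]] := mkqP h.
have [a1 [b1 [c1 [d1 ->]]]] := mkqP p; have [a2 [b2 [c2 [d2 ->]]]] := mkqP q.
by rewrite qmul_lock !mkqE; congr mkim; ring.
Qed.

Lemma dotv_mul h p : dotv (qmul h p) (qmul h p) = dotv h h * dotv p p.
Proof.
have [a [b [c [d ->]]]] := mkqP h; have [a1 [b1 [c1 [d1 ->]]]] := mkqP p.
by rewrite qmul_lock !mkqE; ring.
Qed.

End QuaternionAlgebra.

Section EuclideanNorm.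
Context {R : realType} {n : nat}.
Implicit Types (u v w : 'rV[R]_n) (k : R).

Lemma dotvC u v : dotv u v = dotv v u.
Proof. by apply: eq_bigr => i _; rewrite mulrC. Qed.

Lemma dotvDr u v w : dotv u (v + w) = dotv u v + dotv u w.
Proof.
by rewrite -big_split; apply: eq_bigr => i _; rewrite mxE mulrDr.
Qed.

Lemma dotvZr k u v : dotv u (k *: v) = k * dotv u v.
Proof.
by rewrite mulr_sumr; apply: eq_bigr => i _; rewrite mxE mulrCA.
Qed.

Lemma dotvZl k u v : dotv (k *: u) v = k * dotv u v.
Proof. by rewrite dotvC dotvZr dotvC. Qed.

Lemma dotv0l v : dotv 0 v = 0.
Proof. by rewrite /dotv big1 // => i _; rewrite mxE mul0r. Qed.

Lemma dotv_ge0 v : 0 <= dotv v v.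
Proof. by apply: sumr_ge0 => i _; rewrite -expr2 sqr_ge0. Qed.

Lemma dotv_eq0 v : (dotv v v == 0) = (v == 0).
Proof.
apply/eqP/eqP => [E|->]; last exact: dotv0l.
apply/rowP => i; rewrite mxE; apply/eqP; rewrite -sqrf_eq0 expr2.
rewrite -expr2; apply/eqP.
have v2 : \sum_i v 0 i ^+ 2 = 0.
  by rewrite -[RHS]E; apply: eq_bigr => j _; rewrite expr2.
exact: (psumr_eq0P (fun j _ => sqr_ge0 (v 0 j)) v2).
Qed.

Lemma enorm_sqr v : enorm v ^+ 2 = dotv v v.
Proof. by rewrite sqr_sqrtr // dotv_ge0. Qed.

Lemma enorm_eq0 v : (enorm v == 0) = (v == 0).
Proof. by rewrite -dotv_eq0 -enorm_sqr sqrf_eq0. Qed.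

Lemma derive_coord (i : 'I_n) w v : 'D_w (fun u => u 0 i) v = w 0 i.
Proof.
rewrite /derive; apply: cvg_lim => //; apply: cvg_near_cst; near=> h.
rewrite /= mxE addrK mxE [_ *: _]mulrA mulVf ?mul1r //.
by near: h; exact: nbhs_dnbhs_neq.
Unshelve. all: by end_near. Qed.

Lemma differentiable_dotv v : differentiable (fun u => dotv u u) v.
Proof.
rewrite (_ : (fun u => _) = \sum_(i < n) (fun u => u 0 i * u 0 i)); last first.
  by rewrite funeqE => u; rewrite fct_sumE.
by apply: differentiable_sum => i; apply: differentiableM; exact: differentiable_coord.
Qed.

Lemma derive_dotv w v : 'D_w (fun u => dotv u u) v = 2 * dotv v w.
Proof.
rewrite (_ : (fun u => _) = \sum_(i < n) (fun u => u 0 i * u 0 i)); last first.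
  by rewrite funeqE => u; rewrite fct_sumE.
have dc i : derivable (fun u : 'rV[R]_n => u 0 i) v w.
  by apply: diff_derivable; exact: differentiable_coord.
rewrite derive_sum => [|i]; last exact: derivableM.
rewrite mulr_sumr; apply: eq_bigr => i _.
by rewrite deriveM // derive_coord /GRing.scale /=; ring.
Qed.

Lemma differentiable_enorm v : v != 0 -> differentiable (@enorm R n) v.
Proof.
move=> v0; apply: (differentiable_comp (f := fun u => dotv u u) (g := Num.sqrt)).
  exact: differentiable_dotv.
apply/derivable1_diffP; have : 0 < dotv v v.
  by rewrite lt_neqAle dotv_ge0 andbT eq_sym dotv_eq0.
by move=> /is_derive1_sqrt[].
Qed.

Lemma derive_enorm w v : v != 0 -> 'D_w (@enorm R n) v = dotv v w / enorm v.
Proof.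
move=> v0; have dn : derivable (@enorm R n) v w.
  by apply: diff_derivable; exact: differentiable_enorm.
have := deriveM dn dn.
rewrite (_ : enorm * enorm = fun u => dotv u u :> R); last first.
  by rewrite funeqE => u; rewrite -enorm_sqr expr2.
rewrite derive_dotv => E; have n0 : enorm v != 0 by rewrite enorm_eq0.
apply: (mulfI n0); rewrite mulrCA mulfV // mulr1.
by move: E; rewrite -[_ *: _]/(enorm v * _) => E; lra.
Qed.

End EuclideanNorm.

Section MaurerCartan.
Context {R : realType}.
Implicit Types v w : 'rV[R]_4.

(** The radial coefficient [k] is left unspecified: multiplied by [qconj v], its term becomes real
    and does not reach the Maurer-Cartan form. *)
Lemma derive_sph v w : v != 0 -> exists k : R,
  'D_w (@sph R) v = (enorm v)^-1 *: w + k *: v.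
Proof.
move=> v0; have n0 : enorm v != 0 by rewrite enorm_eq0.
have dV : derivable (fun u : 'rV[R]_4 => (enorm u)^-1) v w.
  by apply: derivableV => //; apply: diff_derivable; exact: differentiable_enorm.
have dc i : derivable (fun u : 'rV[R]_4 => u 0 i) v w.
  by apply: diff_derivable; exact: differentiable_coord.
have dsph i : is_derive v w (fun u : 'rV[R]_4 => (sph u) 0 i)
    ((enorm v)^-1 * w 0 i + 'D_w (fun u : 'rV[R]_4 => (enorm u)^-1) v * v 0 i).
  rewrite (_ : (fun u => _) = (fun u => (enorm u)^-1) * (fun u => u 0 i)); last first.
    by rewrite funeqE => u; rewrite /sph mxE.
  split; first exact: derivableM.
  by rewrite deriveM // derive_coord; congr (_ + _); rewrite [LHS]mulrC.
exists ('D_w (fun u : 'rV[R]_4 => (enorm u)^-1) v).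
apply/rowP => i; rewrite derive_mx ?mxE; first by case: (dsph i).
by apply/derivable_mxP => k j; rewrite (ord1 k); case: (dsph j).
Qed.

(** Valid at [v = 0] too, where both sides are 0 because the inverse of 0 is 0. *)
Lemma maurer_cartanE v w :
  maurer_cartan v w = (dotv v v)^-1 *: qim (qmul (qconj v) w).
Proof.
have [->|v0] := eqVneq v 0.
  rewrite dotv0l invr0 scale0r /maurer_cartan /sph scaler0.
  by rewrite -[X in qconj X](scale0r (0 : 'rV[R]_4)) im_conj_scale scale0r.
rewrite /maurer_cartan; have [k ->] := derive_sph w v0.
rewrite /sph im_conj_scale im_conj_mul_add im_conj_self addr0 scalerA.
by rewrite -expr2 exprVn enorm_sqr.
Qed.

End MaurerCartan.

(** * Smoothness of quaternion and matrix operations *)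

Section CkQuaternion.
Context {R : realType} {V : normedModType R}.
Implicit Types (U : set V).

Lemma Ck_dotv n U m (f g : V -> 'rV[R]_m) : open U -> Ck n U f -> Ck n U g ->
  Ck n U (fun x => dotv (f x) (g x)).
Proof.
move=> oU Cf Cg; apply: Ck_sum => // k.
by apply: Ck_mul => //; exact: Ck_coord.
Qed.

Lemma Ck_qmul n U (f g : V -> 'rV[R]_4) : open U -> Ck n U f -> Ck n U g ->
  Ck n U (fun x => qmul (f x) (g x)).
Proof.
move=> oU Cf Cg; have C k l := Ck_mul oU (Ck_coord 0 k oU Cf) (Ck_coord 0 l oU Cg).
have CD := fun (f g : V -> R) (Cf : Ck n U f) (Cg : Ck n U g) => Ck_add (f := f) (g := g) oU Cf Cg.
have CB := fun (f g : V -> R) (Cf : Ck n U f) (Cg : Ck n U g) => Ck_add oU Cf (Ck_opp oU Cg).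
apply: Ck_mx => // i j.
pose c (k : nat) : 'I_4 := inord k.
case: j => -[|[|[|[|//]]]] jP.
- apply: (Ck_eq oU _
    (CB _ _ (CB _ _ (CB _ _ (C (c 0) (c 0)) (C (c 1) (c 1))) (C (c 2) (c 2))) (C (c 3) (c 3)))).
  by move=> x _; rewrite mxE.
- apply: (Ck_eq oU _
    (CB _ _ (CD _ _ (CD _ _ (C (c 0) (c 1)) (C (c 1) (c 0))) (C (c 2) (c 3))) (C (c 3) (c 2)))).
  by move=> x _; rewrite mxE.
- apply: (Ck_eq oU _
    (CD _ _ (CD _ _ (CB _ _ (C (c 0) (c 2)) (C (c 1) (c 3))) (C (c 2) (c 0))) (C (c 3) (c 1)))).
  by move=> x _; rewrite mxE.
- apply: (Ck_eq oU _
    (CD _ _ (CB _ _ (CD _ _ (C (c 0) (c 3)) (C (c 1) (c 2))) (C (c 2) (c 1))) (C (c 3) (c 0)))).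
  by move=> x _; rewrite mxE.
Qed.

Lemma Ck_qconj n U (f : V -> 'rV[R]_4) : open U -> Ck n U f ->
  Ck n U (fun x => qconj (f x)).
Proof.
move=> oU Cf; apply: Ck_mx => // i j.
have C := Ck_coord 0 j oU Cf.
case E : (j == ord0); first by apply: Ck_eq C => // x _; rewrite mxE E.
by apply: Ck_eq (Ck_opp oU C) => // x _; rewrite mxE E.
Qed.

Lemma Ck_qim n U (f : V -> 'rV[R]_4) : open U -> Ck n U f ->
  Ck n U (fun x => qim (f x)).
Proof.
move=> oU Cf; apply: Ck_mx => // i j.
by apply: Ck_eq (Ck_coord 0 (lift ord0 j) oU Cf) => // x _; rewrite mxE.
Qed.

Lemma Ck_qpure n U (f : V -> 'rV[R]_3) : open U -> Ck n U f ->
  Ck n U (fun x => qpure (f x)).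
Proof.
move=> oU Cf; apply: Ck_mx => // i j.
case E : (unlift ord0 j) => [l|].
  by apply: Ck_eq (Ck_coord 0 l oU Cf) => // x _; rewrite mxE E.
by apply: Ck_eq (Ck_cst n U 0) => // x _; rewrite mxE E.
Qed.

Lemma Ck_mulmx n U (m k l : nat) (f : V -> 'M[R]_(m, k)) (g : V -> 'M[R]_(k, l)) :
  open U -> Ck n U f -> Ck n U g -> Ck n U (fun x => f x *m g x).
Proof.
move=> oU Cf Cg; apply: Ck_mx => // i j.
have C : Ck n U (fun x => \sum_h f x i h * g x h j).
  by apply: Ck_sum => // h; apply: Ck_mul => //; exact: Ck_coord.
by apply: Ck_eq C => // x _; rewrite mxE.
Qed.

Lemma Ck_scale n U (m k : nat) (c : V -> R) (f : V -> 'M[R]_(m, k)) :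
  open U -> Ck n U c -> Ck n U f -> Ck n U (fun x => c x *: f x).
Proof.
move=> oU Cc Cf; apply: Ck_mx => // i j.
by apply: Ck_eq (Ck_mul oU Cc (Ck_coord i j oU Cf)) => // x _; rewrite mxE.
Qed.

Lemma Ck_det n U (m : nat) (f : V -> 'M[R]_m) : open U -> Ck n U f ->
  Ck n U (fun x => \det (f x)).
Proof.
move=> oU Cf; apply: Ck_sum => // sg; apply: Ck_mul => //; first exact: Ck_cst.
by apply: Ck_prod => // i; exact: Ck_coord.
Qed.

Lemma Ck_invmx n U (m : nat) (f : V -> 'M[R]_m) : open U ->
  (forall x, U x -> f x \in unitmx) -> Ck n U f -> Ck n U (fun x => invmx (f x)).
Proof.
move=> oU fU Cf; apply: Ck_mx => // i j.
have Cadj : Ck n U (fun x => cofactor (f x) j i).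
  apply: Ck_mul => //; first exact: Ck_cst.
  apply: Ck_det => //; apply: Ck_mx => // k l.
  by apply: Ck_eq (Ck_coord (lift j k) (lift i l) oU Cf) => // x _; rewrite !mxE.
have CV : Ck n U (fun x => (\det (f x))^-1).
  apply: Ck_inv => // [x /fU|]; last exact: Ck_det.
  by rewrite unitmxE unitfE.
by apply: Ck_eq (Ck_mul oU CV Cadj) => // x Ux; rewrite /invmx fU // !mxE.
Qed.

End CkQuaternion.

Section SubmxCalculus.
Context {R : realType} {n1 n2 : nat}.

Lemma rsubmxZD (h : R) (v x : 'rV[R]_(n1 + n2)) :
  rsubmx (h *: v + x) = h *: rsubmx v + rsubmx x.
Proof. by apply/rowP => k; rewrite !mxE. Qed.

Lemma lsubmxZD (h : R) (v x : 'rV[R]_(n1 + n2)) :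
  lsubmx (h *: v + x) = h *: lsubmx v + lsubmx x.
Proof. by apply/rowP => k; rewrite !mxE. Qed.

Lemma Ck_rsubmx n U : Ck n U (fun p : 'rV[R]_(n1 + n2) => rsubmx p).
Proof.
by apply: Ck_linear => [x|h v x]; [exact: differentiable_rsubmx|exact: rsubmxZD].
Qed.

End SubmxCalculus.

(** * The connection form and the metric on E *)

Section TotalSpace.
Context {R : realType} (Z : orbifold (R := R)).
Context (g : local_metrics Z) (a : local_connections Z) (s : R)
        (t nu theta N iota chi : R -> R).
Hypothesis q : profile_quotients t nu theta N iota chi.
Implicit Types (i : cidx Z) (p xi zeta : 'rV[R]_(4 + 4)).

(* The vertical part of xi for the connection on E. *)
Definition vert i p xi : 'rV[R]_4 :=
  rsubmx xi + qmul (qpure (lsubmx xi *m a i (lsubmx p))) (rsubmx p).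

Lemma etaE i p xi :
  Defs.eta a i p xi = (dotv (rsubmx p) (rsubmx p))^-1 *:
                 qim (qmul (qconj (rsubmx p)) (vert i p xi)).
Proof.
rewrite /Defs.eta maurer_cartanE /sph im_conj_pure exprVn enorm_sqr -scalerDr.
by rewrite -[X in _ + X]scale1r addrC -im_conj_mul_add scale1r.
Qed.

Lemma derive_radius p xi : rsubmx p != 0 ->
  'D_xi (Defs.radius (R := R)) p = dotv (rsubmx p) (rsubmx xi) / Defs.radius p.
Proof.
move=> v0; rewrite -derive_enorm //.
rewrite -(@derive_comp_affine _ _ _ _ enorm
  (fun u : 'rV[R]_(4 + 4) => rsubmx u) (fun w => rsubmx w)) //.
by move=> h; exact: rsubmxZD.
Qed.

Lemma dotv_vert i p xi : dotv (rsubmx p) (vert i p xi) = dotv (rsubmx p) (rsubmx xi).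
Proof. by rewrite dotvDr dotv_pure_mul addr0. Qed.

(** By [dotv_im_conj], [t ^ 2 |eta| ^ 2] is [theta ^ 2 |Dv| ^ 2] minus
    [theta ^ 2 <v, dv> ^ 2 / r ^ 2], while [dr ^ 2 = <v, dv> ^ 2 / r ^ 2]. The two radial terms
    combine to the coefficient [(1 - theta ^ 2) / r ^ 2 = chi], which is regular at the zero
    section, and the case distinction in [gTheta] disappears. *)
Lemma gThetaE i p xi zeta :
  gTheta g a s t nu i p xi zeta =
  theta (Defs.radius p) ^+ 2 * dotv (vert i p xi) (vert i p zeta)
  + chi (Defs.radius p) * (dotv (rsubmx p) (rsubmx xi) * dotv (rsubmx p) (rsubmx zeta))
  + s * N (Defs.radius p) / 48 * bil (g i (lsubmx p)) (lsubmx xi) (lsubmx zeta).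
Proof.
rewrite /gTheta (nu_N q) ?sqrtr_ge0 //; congr (_ + _).
have [v0|v0] := eqVneq (rsubmx p) 0.
  rewrite /Defs.radius v0 !dotv0l !(mulr0, mul0r) addr0 /enorm dotv0l sqrtr0 (theta_0 q).
  rewrite expr1n mul1r /vert v0.
  have q0 h : qmul h 0 = 0 :> 'rV[R]_4.
    have := qmul_linear h (-1) 0 0; rewrite scaler0 addr0 => E.
    by rewrite E scaleN1r addNr.
  by rewrite !q0 !addr0.
have r0 : Defs.radius p != 0 by rewrite enorm_eq0.
have r2 : dotv (rsubmx p) (rsubmx p) = Defs.radius p ^+ 2 by rewrite enorm_sqr.
rewrite !derive_radius // !etaE dotvZl dotvZr dotv_im_conj !dotv_vert r2.
rewrite (t_theta q) ?sqrtr_ge0 //.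
have -> : chi (Defs.radius p) = (1 - theta (Defs.radius p) ^+ 2) / Defs.radius p ^+ 2.
  by rewrite (theta_chi q) mulrAC mulfV ?mul1r // expf_neq0.
by field.
Qed.

Lemma open_Edom i : open (chart i) -> open (Edom i).
Proof.
move=> oc; apply: (open_comp (f := fun p : 'rV[R]_(4 + 4) => lsubmx p)) => // p _.
exact: continuous_lsubmx.
Qed.

Lemma open_Edom_punctured i : open (chart i) -> open (Edom_punctured i).
Proof.
move=> oc; rewrite (_ : Edom_punctured i = Edom i `&`
  (fun p => dotv (rsubmx p) (rsubmx p)) @^-1` [set x | x != 0]); last first.
  by apply/seteqP; split => p [] /= Ep; rewrite dotv_eq0.
apply: openI; first exact: open_Edom.
apply: open_comp; last exact: open_neq.
move=> p _; apply: (@Ck_continuous_at _ _ _ 0 setT) => //.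
by apply: Ck_dotv; [exact: openT|exact: Ck_rsubmx|exact: Ck_rsubmx].
Qed.

Lemma Ck_vert n (U : set 'rV[R]_(4 + 4)) i xi : open U -> U `<=` Edom i ->
  smooth_on (chart i) (a i) -> Ck n U (fun p => vert i p xi).
Proof.
move=> oU UE /smooth_on_Ck Ca; apply: Ck_add => //; first exact: Ck_cst.
apply: Ck_qmul => //; last exact: Ck_rsubmx.
apply: Ck_qpure => //; apply: Ck_mulmx => //; first exact: Ck_cst.
apply: (Ck_comp_affine (U' := chart i) (L := fun p => lsubmx p) (l := fun p => lsubmx p)) => //.
- exact: differentiable_lsubmx.
- exact: lsubmxZD.
Qed.

Lemma Ck_radius n (U : set 'rV[R]_(4 + 4)) (phi : R -> R) : open U ->
  smooth phi -> even_fun phi -> Ck n U (fun p => phi (Defs.radius p)).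
Proof.
move=> oU Cp ep; apply: Ck_radial => // [y|k]; first exact: dotv_ge0.
by apply: Ck_dotv => //; exact: Ck_rsubmx.
Qed.

Lemma Ck_gTheta n i xi zeta : open (chart i) ->
  smooth_on (chart i) (a i) -> smooth_on (chart i) (g i) ->
  Ck n (Edom i) (fun p => gTheta g a s t nu i p xi zeta).
Proof.
move=> oc Ca Cg; have oE := open_Edom oc.
have Cv xi' : Ck n (Edom i) (fun p => vert i p xi') by exact: Ck_vert.
have Cc c : Ck n (Edom i) (fun _ => c : R) by exact: Ck_cst.
have Cr u : Ck n (Edom i) (fun p => dotv (rsubmx p) u).
  by apply: Ck_dotv => //; [exact: Ck_rsubmx|exact: Ck_cst].
have Cb : Ck n (Edom i) (fun p => bil (g i (lsubmx p)) (lsubmx xi) (lsubmx zeta)).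
  apply: Ck_coord => //; apply: Ck_mulmx => //; last exact: Ck_cst.
  apply: Ck_mulmx => //; first exact: Ck_cst.
  apply: (Ck_comp_affine (U' := chart i) (L := fun p => lsubmx p) (l := fun p => lsubmx p)) => //.
  - exact: differentiable_lsubmx.
  - exact: lsubmxZD.
  - by move: n {Cv Cc Cr}; apply/smooth_on_Ck.
have Cth := Ck_exp 2 oE (Ck_radius n oE (theta_smooth q) (theta_even q)).
have Cch := Ck_radius n oE (chi_smooth q) (chi_even q).
have CN := Ck_radius n oE (N_smooth q) (N_even q).
have C1 := Ck_mul oE Cth (Ck_dotv oE (Cv xi) (Cv zeta)).
have C2 := Ck_mul oE Cch (Ck_mul oE (Cr (rsubmx xi)) (Cr (rsubmx zeta))).
have C3 := Ck_mul oE (Ck_mul oE (Ck_mul oE (Cc s) CN) (Cc 48^-1)) Cb.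
apply: Ck_eq (Ck_add oE (Ck_add oE C1 C2) C3) => // p _.
by rewrite gThetaE.
Qed.

End TotalSpace.

(** * Straight lines as unique geodesics *)

Section LocalLipschitz.
Context {R : realType} {m : nat}.
Implicit Types (f : 'rV[R]_m -> R) (v x : 'rV[R]_m).

Lemma ler_coord_norm v k : `|v 0 k| <= `|v|.
Proof.
rewrite [leRHS]/Num.norm /= mx_normrE.
exact: (le_bigmax _ (fun i => `|v i.1 i.2|) (0, k)).
Qed.

Lemma derive_sum_coord f v x : differentiable f x ->
  'D_v f x = \sum_k v 0 k * 'D_(delta_mx 0 k) f x.
Proof.
move=> df; rewrite deriveE // {1}(row_sum_delta v) linear_sum.
by apply: eq_bigr => k _; rewrite linearZ deriveE.
Qed.

(** A ball is convex, so the mean value theorem applies along the segment from [y'] to [y]. [Ck 2]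
    is asked for because [Ck 1] is mere differentiability, without the continuity that bounds the
    partial derivatives near [x]. *)
Lemma local_lipschitz f (U : set 'rV[R]_m) x : open U -> Ck 2 U f -> U x ->
  exists2 L, 0 <= L & exists2 d, 0 < d &
    forall y y', `|x - y| < d -> `|x - y'| < d -> `|f y - f y'| <= L * `|y - y'|.
Proof.
move=> oU [df Df] Ux.
pose M k := `|'D_(delta_mx 0 k) f x| + 1.
have nMk k : \forall y \near x, `|'D_(delta_mx 0 k) f y| <= M k.
  have := @Ck_continuous_at _ _ _ 0 U _ x (Df (delta_mx 0 k)) Ux.
  move/cvgrPdist_le => /(_ 1 ltr01); apply: filterS => y.
  rewrite /M => h; rewrite -lerBlDl (le_trans _ h) // distrC.
  by rewrite (le_trans _ (lerB_dist _ _)).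
have nM : \forall y \near x, forall k, `|'D_(delta_mx 0 k) f y| <= M k.
  exact: (filter_forall (f := fun k => [set y | `|'D_(delta_mx 0 k) f y| <= M k])) nMk.
have nU : \forall y \near x, U y by exact: open_nbhs_nbhs.
have [d /= d0 dP] := (nbhs_ballP x _).1 (filterI nM nU).
have {}dP y : `|x - y| < d ->
    (forall k, `|'D_(delta_mx 0 k) f y| <= M k) /\ U y.
  by move=> xy; apply: dP; rewrite -ball_normE.
pose L := \sum_k M k.
exists L; first by apply: sumr_ge0 => k _; rewrite addr_ge0.
exists d => // y y' xy xy'.
pose l (s : R) : 'rV[R]_m := s *: (y - y') + y'.
have lU (s : R) : 0 <= s <= 1 -> `|x - l s| < d.
  move=> /andP[s0 s1].
  have -> : x - l s = s *: (x - y) + (1 - s) *: (x - y').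
    by rewrite /l; apply/rowP => k; rewrite !mxE; ring.
  rewrite (le_lt_trans (ler_normD _ _)) // !normrZ ger0_norm // ger0_norm ?subr_ge0 //.
  move: s0; rewrite le_eqVlt => /orP[/eqP<-|s0].
    by rewrite mul0r add0r subr0 mul1r.
  have -> : d = s * d + (1 - s) * d by ring.
  by rewrite ltr_leD ?ltr_pM2l // ler_wpM2l ?subr_ge0 // ltW.
have dl s : differentiable l s.
  apply: differentiableD => //; exact: differentiableZl.
have der (s : R) : 0 <= s <= 1 ->
    is_derive s (1 : R) (fun s : R => f (l s)) ('D_(y - y') f (l s)).
  move=> s01; have [_ Us] := dP _ (lU s s01).
  have df' : differentiable (f \o l) s by apply: differentiable_comp => //; exact: df.
  split; first by apply: diff_derivable.
  rewrite (@derive_comp_affine _ _ _ _ f l (fun h => h *: (y - y'))) ?scale1r //.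
  by move=> h; rewrite /l scalerDl -addrA [h *: 1]mulr1.
have [||s s01] := MVT_segment (@ler01 R) (f := fun s : R => f (l s))
  (df := fun s : R => 'D_(y - y') f (l s)).
- by move=> s /itvP s01; apply: der; rewrite !s01.
- apply: continuous_in_subspaceT => s; rewrite inE /= => /itvP s01.
  have [|D _] := der s; first by rewrite !s01.
  by apply: differentiable_continuous; exact/derivable1_diffP.
rewrite subr0 mulr1 /l scale1r scale0r add0r subrK => ->.
have [Ms Us] : (forall k, `|'D_(delta_mx 0 k) f (l s)| <= M k) /\ U (l s).
  by apply: dP; apply: lU; rewrite !(itvP s01).
rewrite derive_sum_coord; last exact: df.
rewrite (le_trans (ler_norm_sum _ _ _)) // mulr_suml ler_sum // => k _.
rewrite normrM mulrC ler_pM //.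
exact: ler_coord_norm.
Qed.

End LocalLipschitz.

Section LastZeroGrowth.
Context {R : realType}.

(** On an interval of length [h] with [C h <= 1/2], let [m] be a maximum point of [e]. The mean
    value theorem gives [e m <= C (e m) h <= e m / 2], against [e m > 0]. *)
Lemma growth_last_zero (e e' : R -> R) (C rho : R) : 0 < C -> rho < 1 ->
  (forall tau : R, rho <= tau <= 1 -> is_derive tau (1 : R) e (e' tau)) ->
  e rho = 0 -> (forall tau, rho < tau <= 1 -> 0 < e tau) ->
  (\forall tau \near rho, rho <= tau <= 1 -> e' tau <= C * e tau) -> False.
Proof.
move=> C0 rho1 de erho pos near_e'.
have [r /= r0 rP] := (nbhs_ballP rho _).1 near_e'.
pose h := Num.min (r / 2) (Num.min (1 - rho) (2 * C)^-1).
have h0 : 0 < h by rewrite !lt_min divr_gt0 //= subr_gt0 rho1 invr_gt0 mulr_gt0.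
have hr : h <= r / 2 by rewrite ge_min lexx.
have h1 : rho + h <= 1.
  have : h <= 1 - rho by rewrite !ge_min lexx !orbT.
  by lra.
have hC : C * h <= 2^-1.
  have : h <= (2 * C)^-1 by rewrite !ge_min lexx !orbT.
  by rewrite -(ler_pM2l C0) invfM mulrCA mulfV ?gt_eqF // mulr1.
have in01 tau : rho <= tau <= rho + h -> rho <= tau <= 1.
  by move=> /andP[-> th]; exact: le_trans th h1.
have ce (tau : R) : rho <= tau <= 1 -> {for tau, continuous e}.
  by move=> /de[D _]; apply: differentiable_continuous; exact/derivable1_diffP.
have cwith x : x <= rho + h -> {within `[rho, x], continuous e}.
  move=> xh; apply: continuous_in_subspaceT => tau; rewrite inE /= => /itvP tx.
  by apply: ce; apply: in01; rewrite tx /= (le_trans _ xh) // tx.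
have [|m mh max] := EVT_max _ (cwith _ (lexx _)); first by rewrite lerDl ltW.
have em : 0 < e m.
  apply: lt_le_trans (max (rho + h) _); last by rewrite in_itv /= lexx lerDl ltW.
  by apply: pos; rewrite ltrDl h0.
have rm : rho <= m by rewrite (itvP mh).
have mH : m <= rho + h by rewrite (itvP mh).
have dm x : x \in `]rho, m[ -> is_derive x (1 : R) e (e' x).
  move=> /itvP xm; apply: de; apply: in01.
  by rewrite xm /= (le_trans (y := m)) ?xm.
have [x xm E] := MVT_segment rm dm (cwith m mH).
have xh : rho <= x <= rho + h.
  by rewrite (itvP xm) /= (le_trans (y := m)) ?(itvP xm) // (itvP mh).
have e'x : e' x <= C * e x.
  apply: rP; last exact: in01.
  by rewrite /ball /= distrC ger0_norm ?subr_ge0 ?(andP xh).1 //; move: xh => /andP[_]; lra.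
have ex : e x <= e m by apply: max; rewrite in_itv /=.
have ex0 : 0 <= e x.
  have /andP[] := in01 _ xh; rewrite le_eqVlt => /orP[/eqP<-|rx x1].
    by rewrite erho.
  by rewrite ltW // pos // rx.
have mr : 0 <= m - rho by rewrite subr_ge0 (itvP mh).
have mh' : m - rho <= h by rewrite lerBlDl (itvP mh).
move: E; rewrite erho subr0 => E.
have le1 : e m <= C * e m * h.
  rewrite {1}E (le_trans (ler_wpM2r mr e'x)) //.
  by apply: ler_pM => //; [rewrite mulr_ge0 // ltW|exact: (ler_wpM2l (ltW C0) ex)].
have le2 : C * e m * h <= 2^-1 * e m by rewrite mulrAC ler_wpM2r // ltW.
have le3 : e m <= 2^-1 * e m by exact: le_trans le1 le2.
by lra.
Qed.

Lemma sqr_le_of_norm (A L E : R) : 0 <= E -> `|A| <= L * Num.sqrt E ->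
  A ^+ 2 <= L ^+ 2 * E.
Proof.
move=> E0 h; have := ler_pM (normr_ge0 _) (normr_ge0 _) h h.
by rewrite -normrM -expr2 ger0_norm ?sqr_ge0 // mulrACA -!expr2 sqr_sqrtr.
Qed.

Lemma cross_terms_le (A B B' M : R) : A ^+ 2 <= M ->
  2 * (B * B') + 2 * (B' * A) <=
  (B ^+ 2 + B' ^+ 2) + (B ^+ 2 + B' ^+ 2) + M.
Proof.
have := sqr_ge0 (B - B'); have := sqr_ge0 (B' - A); have := sqr_ge0 B.
by rewrite !sqrrB; lra.
Qed.

End LastZeroGrowth.

Section StraightGeodesics.
Context {R : realType} {n : nat}.
Implicit Types (G : 'rV[R]_n -> 'M[R]_n) (U : set 'rV[R]_n) (p w : 'rV[R]_n).

Lemma norm_row_mx_le (x y : 'rV[R]_n) :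
  `|row_mx x y| <= Num.sqrt (\sum_k (x 0 k ^+ 2 + y 0 k ^+ 2)).
Proof.
rewrite [leLHS]/Num.norm /= mx_normrE; apply: bigmax_le => [|[i j] _ /=].
  exact: sqrtr_ge0.
rewrite mxE (ord1 i) -sqrtr_sqr ler_wsqrtr //.
have S k : x 0 k ^+ 2 + y 0 k ^+ 2 <= \sum_l (x 0 l ^+ 2 + y 0 l ^+ 2).
  rewrite [leRHS](bigD1 k) //= lerDl sumr_ge0 // => l _.
  by rewrite addr_ge0 ?sqr_ge0.
case: splitP => k _; apply: le_trans (S k).
  by rewrite lerDl sqr_ge0.
by rewrite lerDr sqr_ge0.
Qed.

Lemma norm_row_mx0 (x : 'rV[R]_n) : `|row_mx x (0 : 'rV[R]_n)| <= `|x|.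
Proof.
rewrite [leLHS]/Num.norm /= mx_normrE; apply: bigmax_le => // -[i j] _ /=.
rewrite mxE; case: splitP => k _; last by rewrite mxE normr0.
by rewrite (ord1 i) ler_coord_norm.
Qed.

Lemma derivable_row_mx (f h : R -> 'rV[R]_n) x : derivable f x 1 ->
  derivable h x 1 -> derivable (fun y => row_mx (f y) (h y)) x 1.
Proof.
move=> /derivable_mxP df /derivable_mxP dh; apply/derivable_mxP => i j.
case E : (fintype.split j) => [k|k].
  rewrite (_ : (fun y => _) = fun y => f y i k); first exact: df.
  by rewrite funeqE => y; rewrite mxE E.
rewrite (_ : (fun y => _) = fun y => h y i k); first exact: dh.
by rewrite funeqE => y; rewrite mxE E.
Qed.

(** The geodesic acceleration as a function on phase space, position in the left block and velocity
    in the right one, so that a single Lipschitz bound covers both. *)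
Definition quad_christoffel G k (y : 'rV[R]_(n + n)) : R :=
  - \sum_i \sum_j christoffel G k i j (lsubmx y) * rsubmx y 0 i * rsubmx y 0 j.

Lemma Ck_quad_christoffel G U k l : open U ->
  (forall i j, Ck l U (christoffel G k i j)) ->
  Ck l [set y | U (lsubmx y)] (quad_christoffel G k).
Proof.
move=> oU CG.
have oU' : open [set y : 'rV[R]_(n + n) | U (lsubmx y)].
  by apply: open_comp => // y _; exact: continuous_lsubmx.
apply: Ck_opp => //; apply: Ck_sum => // i; apply: Ck_sum => // j.
apply: Ck_mul => //; last by apply: Ck_coord => //; exact: Ck_rsubmx.
apply: Ck_mul => //; last by apply: Ck_coord => //; exact: Ck_rsubmx.
apply: (Ck_comp_affine (U' := U) (f := christoffel G k i j)
  (L := fun y : 'rV[R]_(n + n) => lsubmx y) (l := fun y => lsubmx y)) => //.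
- exact: differentiable_lsubmx.
- exact: lsubmxZD.
Qed.

(* The squared distance e, in phase space, from a geodesic to a straight
   geodesic with the same initial data satisfies e' <= C e after the last zero
   of e, so e has no last zero before 1. *)
Lemma geodesic_line_unique G U p w c d : open U ->
  (forall k i j, Ck 2 U (christoffel G k i j)) ->
  (forall tau, 0 <= tau <= 1 -> U (p + tau *: w)) ->
  (forall tau k, 0 <= tau <= 1 ->
     quad_christoffel G k (row_mx (p + tau *: w) w) = 0) ->
  0 < d -> geodesic_on G U `](- d), (1 + d)[ c ->
  c 0 = p -> derive1 c 0 = w -> c 1 = p + w.
Proof.
move=> oU CG lineU line0 d0 geo c0 c'0.
have inJ tau : 0 <= tau <= 1 -> `](- d), (1 + d)[%classic tau.
  by move=> /andP[t0 t1]; rewrite /= in_itv /=; apply/andP; split; lra.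
pose u k tau : R := c tau 0 k - (p 0 k + tau * w 0 k).
pose u' k tau : R := derive1 c tau 0 k - w 0 k.
pose u'' k tau : R := quad_christoffel G k (row_mx (c tau) (derive1 c tau)).
have dcoord (f : R -> 'rV[R]_n) (tau : R) k : derivable f tau 1 ->
    is_derive tau (1 : R) (fun t => f t 0 k) (derive1 f tau 0 k).
  move=> df; split; first by move/derivable_mxP : df; apply.
  by rewrite derive1E derive_mx ?mxE.
have du k (tau : R) : 0 <= tau <= 1 -> is_derive tau (1 : R) (u k) (u' k tau).
  move=> /inJ/geo[_ dc _ _].
  have D := is_derive_funB (dcoord _ _ k dc) (is_derive_funD (is_derive_cst (p 0 k) tau 1)
    (is_derive_funM (is_derive_id tau 1) (is_derive_cst (w 0 k) tau 1))).
  by apply: (is_derive_eq D); rewrite /u' /cst mulr0 addr0 mul1r add0r.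
have du' k (tau : R) : 0 <= tau <= 1 -> is_derive tau (1 : R) (u' k) (u'' k tau).
  move=> /inJ/geo[_ _ dc Ec].
  have D := is_derive_funB (dcoord _ _ k dc) (is_derive_cst (w 0 k) tau 1).
  by apply: (is_derive_eq D); rewrite subr0 Ec /u'' /quad_christoffel row_mxKl row_mxKr.
pose e tau : R := \sum_k (u k tau ^+ 2 + u' k tau ^+ 2).
pose e' tau : R := \sum_k (2 * (u k tau * u' k tau) + 2 * (u' k tau * u'' k tau)).
have de (tau : R) : 0 <= tau <= 1 -> is_derive tau (1 : R) e (e' tau).
  move=> t01.
  have -> : e = \sum_(k < n) (fun tau => u k tau * u k tau + u' k tau * u' k tau).
    by rewrite funeqE => t; rewrite fct_sumE; apply: eq_bigr => k _; rewrite !expr2.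
  have D k := is_derive_funD (is_derive_funM (du k tau t01) (du k tau t01))
    (is_derive_funM (du' k tau t01) (du' k tau t01)).
  apply: (is_derive_eq (is_derive_sum D)).
  by apply: eq_bigr => k _; ring.
have ce (tau : R) : 0 <= tau <= 1 -> {for tau, continuous e}.
  move=> /de[D _]; apply: differentiable_continuous; exact/derivable1_diffP.
have e_ge0 tau : 0 <= e tau.
  by apply: sumr_ge0 => k _; rewrite addr_ge0 ?sqr_ge0.
have e0 : e 0 = 0.
  apply: big1 => k _; rewrite /u /u' c0 c'0 mul0r addr0 !subrr.
  by rewrite expr0n addr0.
have e_eq0 tau : e tau = 0 -> c tau = p + tau *: w /\ derive1 c tau = w.
  move=> /eqP; rewrite psumr_eq0 => [/allP E|k _]; last by rewrite addr_ge0 ?sqr_ge0.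
  have {}E k : u k tau = 0 /\ u' k tau = 0.
    have := E k (mem_index_enum k); rewrite implyTb paddr_eq0 ?sqr_ge0 //.
    by rewrite !sqrf_eq0 => /andP[/eqP ? /eqP ?].
  split; apply/rowP => k; have [/eqP Eu /eqP Eu'] := E k.
    by move: Eu; rewrite subr_eq0 => /eqP ->; rewrite !mxE.
  by move: Eu'; rewrite subr_eq0 => /eqP.
suff e1 : e 1 = 0 by have [-> _] := e_eq0 _ e1; rewrite scale1r.
apply/eqP; rewrite eq_le e_ge0 andbT leNgt; apply/negP => e1.
have cNe (tau : R) : 0 <= tau <= 1 -> {for tau, continuous (fun t => - e t)}.
  by move=> /ce h; exact: continuousN.
have [||rho [/andP[rho0 rho1] erho neg]] := last_zero (@ler01 R) cNe.
- by rewrite e0 oppr0.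
- by rewrite oppr_lt0.
have rho01 : 0 <= rho <= 1 by rewrite rho0 ltW.
have {}erho : e rho = 0 by apply/eqP; rewrite -oppr_eq0 erho.
have {neg}pos tau : rho < tau <= 1 -> 0 < e tau.
  by move=> /neg; rewrite oppr_lt0.
have [crho c'rho] := e_eq0 _ erho.
pose line tau := row_mx (p + tau *: w) w.
pose phase tau := row_mx (c tau) (derive1 c tau).
have phase_line tau : `|phase tau - line tau| <= Num.sqrt (e tau).
  have -> : e tau = \sum_k ((c tau - (p + tau *: w)) 0 k ^+ 2
                           + (derive1 c tau - w) 0 k ^+ 2).
    by apply: eq_bigr => k _; rewrite !mxE.
  rewrite /phase /line opp_row_mx add_row_mx; exact: norm_row_mx_le.
(* The acceleration vanishes along the line, so [u''] is a difference of two values of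
   [quad_christoffel], at points of phase space at distance at most [sqrt e]. *)
have near_u'' k : exists L, \forall tau \near rho, 0 <= tau <= 1 ->
    u'' k tau ^+ 2 <= L ^+ 2 * e tau.
  have [||L L0 [r r0 Lip]] := local_lipschitz (x := line rho) _
      (Ck_quad_christoffel oU (CG k)).
  - by apply: open_comp => // z _; exact: continuous_lsubmx.
  - by rewrite /line /= row_mxKl; exact: lineU.
  exists L.
  have cphase : \forall tau \near rho, `|line rho - phase tau| < r.
    have Dp : differentiable phase rho.
      have [_ dc dc' _] := geo _ (inJ _ rho01).
      by apply/derivable1_diffP; exact: derivable_row_mx.
    have -> : line rho = phase rho by rewrite /line /phase crho c'rho.
    by have /cvgrPdist_lt := differentiable_continuous Dp; exact.
  have cline : \forall tau \near rho, `|line rho - line tau| < r.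
    have /cvgrPdist_lt/(_ _ r0) : {for rho, continuous (fun tau : R => tau *: w)}.
      exact: scalel_continuous.
    apply: filterS => tau; apply: le_lt_trans.
    rewrite /line opp_row_mx add_row_mx subrr opprD addrACA subrr add0r.
    exact: norm_row_mx0.
  near=> tau => t01.
  rewrite -[u'' k tau]subr0 -(line0 tau k t01).
  have h : `|u'' k tau - quad_christoffel G k (line tau)| <= L * Num.sqrt (e tau).
    rewrite (le_trans (Lip _ _ _ _)) //; [by near: tau|by near: tau|].
    exact: (ler_wpM2l L0 (phase_line tau)).
  exact: sqr_le_of_norm (e_ge0 tau) h.
have [L LP] := choice near_u''.
(* The 2 absorbs the products of [u], [u'] and [u'']; each [L k ^ 2] comes from the Lipschitz bound
   on the square of [u'' k]. *)
pose C := 2 + \sum_k L k ^+ 2.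
have C0 : 0 < C by rewrite ltr_wpDr // sumr_ge0 // => k _; exact: sqr_ge0.
have near_e' : \forall tau \near rho, 0 <= tau <= 1 -> e' tau <= C * e tau.
  have LA : \forall tau \near rho, forall k, 0 <= tau <= 1 ->
      u'' k tau ^+ 2 <= L k ^+ 2 * e tau.
    exact: (@filter_forall _ 'I_n (fun k tau => 0 <= tau <= 1 ->
      u'' k tau ^+ 2 <= L k ^+ 2 * e tau) (nbhs rho) _ LP).
  apply: filterS LA => tau H t01.
  have -> : C * e tau = \sum_k ((u k tau ^+ 2 + u' k tau ^+ 2)
      + (u k tau ^+ 2 + u' k tau ^+ 2) + L k ^+ 2 * e tau).
    by rewrite big_split /= -mulr_suml big_split /= -/(e tau) /C; ring.
  by apply: ler_sum => k _; apply: cross_terms_le; exact: H.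
by apply: (growth_last_zero C0 rho1 _ erho pos _) => [tau /andP[rt t1]|];
  [apply: de; rewrite t1 (le_trans rho0)|
   apply: filterS near_e' => tau H /andP[rt t1]; apply: H; rewrite t1 (le_trans rho0)].
Unshelve. all: by end_near. Qed.

End StraightGeodesics.

(** * Christoffel symbols along a straight line *)

Section ChristoffelSymbols.
Context {R : realType} {n : nat}.
Implicit Types (G : 'rV[R]_n -> 'M[R]_n) (P W : 'rV[R]_n).

Lemma derive_line_cst (V V' : normedModType R) (f : V -> V') (x v : V) :
  (forall h, f (h *: v + x) = f x) -> 'D_v f x = 0.
Proof.
move=> fx; rewrite /derive; apply: cvg_lim => //; apply: cvg_near_cst; near=> h.
by rewrite /= fx subrr scaler0.
Unshelve. all: by end_near. Qed.

Lemma derive_line_affine (V V' : normedModType R) (f : V -> V') (x v : V) (w : V') :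
  (forall h, f (h *: v + x) = h *: w + f x) -> 'D_v f x = w.
Proof.
move=> fx; rewrite /derive; apply: cvg_lim => //; apply: cvg_near_cst; near=> h.
rewrite /= fx addrK scalerA mulVf ?scale1r //.
by near: h; exact: nbhs_dnbhs_neq.
Unshelve. all: by end_near. Qed.

Lemma pd_contract (f : 'rV[R]_n -> R) W P : differentiable f P ->
  \sum_i W 0 i * pd i f P = 'D_W f P.
Proof. by move=> df; rewrite (derive_sum_coord W df). Qed.

Lemma derive_lincomb (F : 'I_n -> 'rV[R]_n -> R) (k : 'I_n -> R) W P :
  (forall j, differentiable (F j) P) ->
  'D_W (fun y => \sum_j k j * F j y) P = \sum_j k j * 'D_W (F j) P.
Proof.
move=> dF; rewrite (_ : (fun y => _) = \sum_(j < n) (k j *: F j)); last first.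
  by rewrite funeqE => y; rewrite fct_sumE.
rewrite derive_sum => [|j]; last by apply: derivableZ; exact: diff_derivable.
by apply: eq_bigr => j _; rewrite deriveZ //; exact: diff_derivable.
Qed.

Lemma differentiable_lincomb (F : 'I_n -> 'rV[R]_n -> R) (k : 'I_n -> R) P :
  (forall j, differentiable (F j) P) ->
  differentiable (fun y => \sum_j k j * F j y) P.
Proof.
move=> dF; rewrite (_ : (fun y => _) = \sum_(j < n) (k j *: F j)); last first.
  by rewrite funeqE => y; rewrite fct_sumE.
by apply: differentiable_sum => j; exact: differentiableZ.
Qed.

Lemma christoffel_contract0 G P W :
  (forall i j, differentiable (fun y => G y i j) P) ->
  (forall l, 'D_W (fun y => \sum_j W 0 j * G y j l) P = 0) ->
  (forall l, pd l (fun y => \sum_i W 0 i * \sum_j W 0 j * G y i j) P = 0) ->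
  forall k, \sum_i \sum_j christoffel G k i j P * W 0 i * W 0 j = 0.
Proof.
move=> dG E1 E2 k.
pose A l := \sum_i \sum_j W 0 i * (W 0 j * pd i (fun y => G y j l) P).
pose B l := \sum_i \sum_j W 0 i * (W 0 j * pd l (fun y => G y i j) P).
have AE l : \sum_i \sum_j W 0 j * (W 0 i * pd j (fun y => G y i l) P) = A l.
  by rewrite exchange_big.
have A0 l : A l = 0.
  rewrite -(E1 l) derive_lincomb // /A exchange_big; apply: eq_bigr => j _.
  rewrite -pd_contract // mulr_sumr; apply: eq_bigr => i _.
  by rewrite mulrCA.
have B0 l : B l = 0.
  rewrite -(E2 l) /pd derive_lincomb => [|i]; last exact: differentiable_lincomb.
  by apply: eq_bigr => i _; rewrite derive_lincomb // mulr_sumr.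
have -> : \sum_i \sum_j christoffel G k i j P * W 0 i * W 0 j =
    2^-1 * \sum_l invmx (G P) k l * (A l + A l - B l).
  rewrite mulr_sumr; transitivity (\sum_i \sum_j \sum_l 2^-1 * (invmx (G P) k l *
    (W 0 i * (W 0 j * pd i (fun y => G y j l) P) + W 0 j * (W 0 i * pd j (fun y => G y i l) P)
     - W 0 i * (W 0 j * pd l (fun y => G y i j) P)))).
    apply: eq_bigr => i _; apply: eq_bigr => j _.
    rewrite /christoffel mulr_sumr !mulr_suml; apply: eq_bigr => l _; ring.
  under eq_bigr do rewrite exchange_big /=.
  rewrite exchange_big /=; apply: eq_bigr => l _.
  rewrite -[RHS]/(2^-1 * (invmx (G P) k l * (A l + A l - B l))).
  rewrite -{2}(AE l) /A /B -big_split -sumrB !mulr_sumr.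
  apply: eq_bigr => i _; rewrite -big_split -sumrB !mulr_sumr.
  by apply: eq_bigr => j _.
by rewrite big1 ?mulr0 // => l _; rewrite A0 B0 addr0 subr0 mulr0.
Qed.

Lemma Ck_christoffel l G (U : set 'rV[R]_n) k i j : open U ->
  (forall m, Ck m U G) -> (forall x, U x -> G x \in unitmx) ->
  Ck l U (christoffel G k i j).
Proof.
move=> oU CG uG; apply: Ck_mul => //; first exact: Ck_cst.
apply: Ck_sum => // m; apply: Ck_mul => //.
  by apply: Ck_coord => //; exact: Ck_invmx.
have Cpd a b c : Ck l U (pd a (fun y => G y b c)).
  by have [_] := Ck_coord b c oU (CG l.+1); exact.
apply: Ck_add => //; last by apply: Ck_opp => //; exact: Cpd.
by apply: Ck_add => //; exact: Cpd.
Qed.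

(** [riem_exp] is a choice, so its value is known only once an endpoint exists, here that of the
    line, and is unique. *)
Lemma riem_exp_line G (U : set 'rV[R]_n) p w : open U ->
  (forall m, Ck m U G) -> (forall x, U x -> G x \in unitmx) ->
  (forall tau : R, U (p + tau *: w)) ->
  (forall (tau : R) k,
     \sum_i \sum_j christoffel G k i j (p + tau *: w) * w 0 i * w 0 j = 0) ->
  riem_exp G U p w = p + w.
Proof.
move=> oU CG uG lineU line0.
have quad0 tau k : quad_christoffel G k (row_mx (p + tau *: w) w) = 0.
  by rewrite /quad_christoffel row_mxKl row_mxKr line0 oppr0.
rewrite /riem_exp; apply: xget_unique => [|q [c [d [d0 geo c0 c'0 <-]]]]; last first.
  apply: (geodesic_line_unique oU _ _ _ d0 geo) => //.
  by move=> k i j; exact: Ck_christoffel.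
have Dc (tau : R) : is_derive tau (1 : R) (fun s : R => p + s *: w) w.
  have dc : differentiable (fun s : R => p + s *: w) tau.
    by apply: differentiableD => //; exact: differentiableZl.
  split; first exact: diff_derivable.
  apply: derive_line_affine => h; rewrite [h *: 1]mulr1 scalerDl addrCA.
  by rewrite addrC.
have c'E : derive1 (fun s : R => p + s *: w) = fun=> w.
  by rewrite funeqE => tau; rewrite derive1E; case: (Dc tau).
exists (fun s => p + s *: w), 1; split => //.
- move=> tau _; rewrite c'E; split; [exact: lineU|by case: (Dc tau)|exact: derivable_cst|].
  by move=> k; rewrite derive1_cst mxE line0 oppr0.
- by rewrite scale0r addr0.
- by rewrite c'E.
- by rewrite scale1r.
Qed.

End ChristoffelSymbols.

(** * Geodesics in the fibers of E *)

Section FiberGeodesics.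
Context {R : realType} (Z : orbifold (R := R)).
Context (g : local_metrics Z) (a : local_connections Z) (s : R)
        (t nu theta N iota chi : R -> R).
Hypothesis q : profile_quotients t nu theta N iota chi.
Hypotheses (s_gt0 : 0 < s) (gmetric : riemannian_metric g).
Hypothesis a_smooth : forall i, smooth_on (chart i) (a i).
Implicit Types (i : cidx Z) (p xi zeta : 'rV[R]_(4 + 4)).

Let gT i p xi zeta := gTheta g a s t nu i p xi zeta.

Lemma qpure_linear (k : R) (u v : 'rV[R]_3) : qpure (k *: u + v) = k *: qpure u + qpure v.
Proof.
apply/rowP => j; rewrite !mxE; case: unliftP => [l _|_]; rewrite ?mxE //.
by rewrite mulr0 addr0.
Qed.

Lemma qmul_linearl (k : R) (u v h : 'rV[R]_4) :
  qmul (k *: u + v) h = k *: qmul u h + qmul v h.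
Proof.
have [a0 [b [c [d ->]]]] := mkqP h.
have [a1 [b1 [c1 [d1 ->]]]] := mkqP u; have [a2 [b2 [c2 [d2 ->]]]] := mkqP v.
by rewrite qmul_lock !mkqE; congr mkq; ring.
Qed.

Lemma vert_linear i p (k : R) xi zeta :
  vert a i p (k *: xi + zeta) = k *: vert a i p xi + vert a i p zeta.
Proof.
rewrite /vert rsubmxZD lsubmxZD mulmxDl -scalemxAl qpure_linear qmul_linearl.
by rewrite scalerDr addrACA.
Qed.

Lemma bil_linearl m (M : 'M[R]_m) (k : R) u u' v :
  bil M (k *: u + u') v = k * bil M u v + bil M u' v.
Proof. by rewrite /bil !mulmxDl -!scalemxAl mxE mxE. Qed.

Lemma bil_linearr m (M : 'M[R]_m) (k : R) u u' v :
  bil M v (k *: u + u') = k * bil M v u + bil M v u'.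
Proof. by rewrite /bil linearP /= mulmxDr -scalemxAr mxE mxE. Qed.

Lemma gTheta_linearl i p (k : R) xi xi' zeta :
  gT i p (k *: xi + xi') zeta = k * gT i p xi zeta + gT i p xi' zeta.
Proof.
rewrite /gT !(gThetaE _ _ _ q) vert_linear rsubmxZD lsubmxZD bil_linearl.
move: (vert a i p xi) (vert a i p xi') (vert a i p zeta) => u u' z.
by rewrite !(dotvC _ z) !dotvDr !dotvZr; ring.
Qed.

Lemma gTheta_linearr i p (k : R) xi zeta zeta' :
  gT i p xi (k *: zeta + zeta') = k * gT i p xi zeta + gT i p xi zeta'.
Proof.
rewrite /gT !(gThetaE _ _ _ q) vert_linear rsubmxZD lsubmxZD bil_linearr.
move: (vert a i p xi) (vert a i p zeta) (vert a i p zeta') => u z z'.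
by rewrite !dotvDr !dotvZr; ring.
Qed.

Lemma linear_coordv m (f : 'rV[R]_m -> R) (W : 'rV[R]_m) :
  (forall k u v, f (k *: u + v) = k * f u + f v) ->
  \sum_j W 0 j * f (coordv j) = f W.
Proof.
move=> lf; have f0 : f 0 = 0.
  by have := lf (-1) 0 0; rewrite scaler0 addr0 mulN1r addNr.
have fD u v : f (u + v) = f u + f v by have := lf 1 u v; rewrite scale1r mul1r.
have fZ k u : f (k *: u) = k * f u by have := lf k u 0; rewrite !addr0 f0 addr0.
rewrite [in RHS](row_sum_delta W) (big_morph f fD f0).
by apply: eq_bigr => j _; rewrite fZ.
Qed.

Lemma gTheta_mx_contract1 i p (W : 'rV[R]_(4 + 4)) l :
  \sum_j W 0 j * gTheta_mx g a s t nu i p j l = gT i p W (coordv l).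
Proof.
rewrite -(linear_coordv (f := fun W => gT i p W (coordv l)) W); last first.
  by move=> k u v; exact: gTheta_linearl.
by apply: eq_bigr => j _; rewrite mxE.
Qed.

Lemma gTheta_mx_contract2 i p (W : 'rV[R]_(4 + 4)) :
  \sum_k W 0 k * \sum_j W 0 j * gTheta_mx g a s t nu i p k j = gT i p W W.
Proof.
rewrite -(linear_coordv (f := fun V => gT i p V W) W); last first.
  by move=> k u v; exact: gTheta_linearl.
apply: eq_bigr => k _; congr (_ * _).
rewrite -(linear_coordv (f := fun V => gT i p (coordv k) V) W); last first.
  by move=> l u v; exact: gTheta_linearr.
by apply: eq_bigr => j _; rewrite mxE.
Qed.

Lemma qmul0 (h : 'rV[R]_4) : qmul 0 h = 0.
Proof. by have := qmul_linearl (-1) 0 0 h; rewrite scaler0 addr0 scaleN1r addNr. Qed.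

Lemma vert_vertical i p xi : lsubmx xi = 0 -> vert a i p xi = rsubmx xi.
Proof.
move=> x0; rewrite /vert x0 mul0mx.
have -> : qpure 0 = 0 :> 'rV[R]_4.
  by have := qpure_linear (-1) 0 0; rewrite scaler0 addr0 scaleN1r addNr.
by rewrite qmul0 addr0.
Qed.

Lemma gTheta_vertical i p xi zeta : lsubmx xi = 0 -> gT i p xi zeta =
  theta (Defs.radius p) ^+ 2 * dotv (rsubmx xi) (vert a i p zeta)
  + chi (Defs.radius p) * (dotv (rsubmx p) (rsubmx xi) * dotv (rsubmx p) (rsubmx zeta)).
Proof.
move=> x0; rewrite /gT (gThetaE _ _ _ q) vert_vertical // x0.
have -> : bil (g i (lsubmx p)) 0 (lsubmx zeta) = 0 by rewrite /bil !mul0mx mxE.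
by rewrite mulr0 addr0.
Qed.

(** All three terms are nonnegative, since [theta <= 1] forces [r ^ 2 chi >= 0]. The base term is
    positive unless [xi] is vertical, and then [vert] is the nonzero [rsubmx xi]. This is what makes
    [gTheta_mx] invertible. *)
Lemma gTheta_gt0 i p xi : Edom i p -> xi != 0 -> 0 < gT i p xi xi.
Proof.
have [_ _ gpos _] := gmetric => Ep xi0; rewrite /gT (gThetaE _ _ _ q).
have N1 : 0 < s * N (Defs.radius p) / 48.
  by rewrite divr_gt0 // mulr_gt0 // (N_gt0 q).
have T1 : 0 < theta (Defs.radius p) ^+ 2 by rewrite exprn_gt0 // (theta_gt0 q).
have chi0 : 0 <= chi (Defs.radius p) * (dotv (rsubmx p) (rsubmx xi) * dotv (rsubmx p) (rsubmx xi)).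
  have [v0|v0] := eqVneq (rsubmx p) 0; first by rewrite v0 dotv0l mul0r mulr0.
  rewrite mulr_ge0 // -?expr2 ?sqr_ge0 //.
  have r0 : 0 < Defs.radius p by rewrite lt_neqAle sqrtr_ge0 eq_sym enorm_eq0 v0.
  rewrite -(@pmulr_rge0 _ (Defs.radius p ^+ 2)) ?exprn_gt0 // -(theta_chi q) subr_ge0.
  by rewrite expr_le1 ?(theta_le1 q) // ltW // (theta_gt0 q).
have [x0|x0] := eqVneq (lsubmx xi) 0; last first.
  apply: ltr_wpDl; last by rewrite mulr_gt0 // gpos.
  by apply: addr_ge0 => //; apply: mulr_ge0; [exact: ltW|exact: dotv_ge0].
have v0 : rsubmx xi != 0.
  by apply: contra_neq xi0 => v0; rewrite -[xi]hsubmxK x0 v0 row_mx0.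
have vE := vert_vertical i p x0.
have b0 : bil (g i (lsubmx p)) (lsubmx xi) (lsubmx xi) = 0.
  by rewrite x0 /bil !mul0mx mxE.
rewrite b0 mulr0 addr0 ltr_wpDr // mulr_gt0 // vE lt_neqAle dotv_ge0 andbT.
by rewrite eq_sym dotv_eq0.
Qed.

Lemma gTheta_mx_unit i p : Edom i p -> gTheta_mx g a s t nu i p \in unitmx.
Proof.
move=> Ep; rewrite unitmxE unitfE; apply/det0P => -[W W0 WG].
have := gTheta_gt0 Ep W0.
rewrite -(linear_coordv (f := fun V => gT i p W V) W); last first.
  by move=> l u v; exact: gTheta_linearr.
rewrite big1 ?ltxx // => l _; rewrite -gTheta_mx_contract1.
by move/matrixP/(_ 0 l) : (WG); rewrite [LHS]mxE [RHS]mxE => ->; rewrite mulr0.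
Qed.

Lemma Ck_gTheta_mx m i : open (chart i) -> Ck m (Edom i) (gTheta_mx g a s t nu i).
Proof.
have [gs _ _ _] := gmetric => oc; have oE := open_Edom oc.
apply: Ck_mx => // k l.
have C := Ck_gTheta s q m (coordv k) (coordv l) oc (@a_smooth i) (gs i).
apply: (Ck_eq oE _ C) => p _.
by rewrite mxE.
Qed.

Section Ray.
Variables (i : cidx Z) (x w : 'rV[R]_4).
Let W : 'rV[R]_(4 + 4) := row_mx 0 w.
Let ray (tau : R) : 'rV[R]_(4 + 4) := row_mx x 0 + tau *: W.

Let rayE tau : ray tau = row_mx x (tau *: w).
Proof. by rewrite /ray scale_row_mx add_row_mx scaler0 addr0 add0r. Qed.

Let lW : lsubmx W = 0. Proof. by rewrite row_mxKl. Qed.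
Let rW : rsubmx W = w. Proof. by rewrite row_mxKr. Qed.

(** The Gauss lemma in a fiber: on the ray [v] is parallel to [w], so the connection term is
    orthogonal to [w] and the rest carries the factor [theta ^ 2 + r ^ 2 chi = 1]. *)
Lemma gTheta_ray tau zeta : gT i (ray tau) W zeta = dotv w (rsubmx zeta).
Proof.
rewrite gTheta_vertical // rW rayE.
have -> : dotv w (vert a i (row_mx x (tau *: w)) zeta) = dotv w (rsubmx zeta).
  have [->|t0] := eqVneq tau 0.
    rewrite /vert row_mxKr scale0r.
    move: (qpure _) => u; have := qmul_linear u (-1) 0 0.
    by rewrite scaler0 addr0 scaleN1r addNr => ->; rewrite addr0.
  have := dotv_vert a i (row_mx x (tau *: w)) zeta.
  by rewrite row_mxKr !dotvZl => /(mulfI t0).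
set r := Defs.radius _; have r2 : r ^+ 2 = tau ^+ 2 * dotv w w.
  by rewrite enorm_sqr row_mxKr dotvZl dotvZr mulrA expr2.
have := theta_chi q r; rewrite r2 => E.
have -> : theta r ^+ 2 = 1 - tau ^+ 2 * dotv w w * chi r by rewrite -E opprB addrC subrK.
by rewrite row_mxKr !dotvZl; ring.
Qed.

(* g(W, W) = |w|^2 - chi (|v|^2 |w|^2 - <v, w>^2) and the bracket vanishes to
   second order at multiples v of w. *)
Lemma derive_gTheta_ray tau zeta : 'D_zeta (fun p => gT i p W W) (ray tau) = 0.
Proof.
pose F (p : 'rV[R]_(4 + 4)) := dotv (rsubmx p) (rsubmx p) * dotv w w - dotv (rsubmx p) w ^+ 2.
pose f (p : 'rV[R]_(4 + 4)) := chi (Defs.radius p).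
have gE : (fun p => gT i p W W) = (fun _ => dotv w w) - f * F.
  rewrite funeqE => p; rewrite gTheta_vertical // vert_vertical // rW.
  rewrite -[RHS]/(dotv w w - f p * F p) /f /F -(enorm_sqr (rsubmx p)) -/(Defs.radius p).
  have := theta_chi q (Defs.radius p) => E.
  have -> : theta (Defs.radius p) ^+ 2 = 1 - Defs.radius p ^+ 2 * chi (Defs.radius p).
    by rewrite -E opprB addrC subrK.
  by ring.
have oT := @openT 'rV[R]_(4 + 4).
have Cf : Ck 1 setT f by apply: Ck_radius; [exact: oT|exact: chi_smooth q|exact: chi_even q].
have Crw (u : 'rV[R]_(4 + 4) -> 'rV[R]_4) : Ck 1 setT u ->
    Ck 1 setT (fun p => dotv (rsubmx p) (u p)).
  by move=> Cu; apply: Ck_dotv => //; exact: Ck_rsubmx.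
have CF : Ck 1 setT F.
  apply: Ck_add; [exact: oT| |apply: Ck_opp; first exact: oT].
    apply: Ck_mul; [exact: oT| |exact: Ck_cst].
    by apply: Crw; exact: Ck_rsubmx.
  by apply: Ck_exp; [exact: oT|apply: Crw; exact: Ck_cst].
have df : derivable f (ray tau) zeta by apply: diff_derivable; case: Cf => + _; exact.
have dF : derivable F (ray tau) zeta by apply: diff_derivable; case: CF => + _; exact.
have F0 : F (ray tau) = 0.
  by rewrite /F rayE row_mxKr !dotvZl dotvZr; ring.
have DF : 'D_zeta F (ray tau) = 0.
  (* [F] is the squared area of the parallelogram on [v] and [w], unchanged when a multiple of [w]
     is added to [v]; hence it is purely quadratic in [h]. *)
  pose K := F zeta.
  have FE h : F (h *: zeta + ray tau) = h ^+ 2 * K.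
    rewrite /K /F rsubmxZD rayE row_mxKr.
    move: (rsubmx zeta) => v.
    have E u : dotv (h *: v + tau *: w) u = h * dotv v u + tau * dotv w u.
      by rewrite dotvC dotvDr !dotvZr !(dotvC u).
    rewrite !E [dotv v (_ + _)]dotvC [dotv w (_ + _)]dotvC !E (dotvC w v).
    by ring.
  have := @derive_comp_affine _ _ _ _ F (fun h : R => h *: zeta + ray tau)
    (fun h : R => h *: zeta) (1 : R) (0 : R).
  rewrite scale0r add0r scale1r => <-; last first.
    by move=> h; rewrite addr0 [h *: 1]mulr1.
  rewrite (_ : F \o _ = fun h : R => h ^+ 2 * K); last by rewrite funeqE => h; exact: FE.
  have [_ ->] := is_derive_funM (is_derive_funX (0 : R) 1) (is_derive_cst K (0 : R) 1).
  by rewrite /cst expr1 !(mulr0, mul0r) addr0.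
rewrite gE deriveB; [|exact: derivable_cst|exact: derivableM].
rewrite derive_cst (deriveM df dF) DF F0 scaler0 scale0r addr0; exact: subrr.
Qed.

Lemma christoffel_ray tau k : open (chart i) -> chart i x ->
  \sum_j \sum_l christoffel (gTheta_mx g a s t nu i) k j l (ray tau) * W 0 j * W 0 l = 0.
Proof.
move=> oc cx; have Er : Edom i (ray tau) by rewrite rayE /Edom /= row_mxKl.
apply: christoffel_contract0 => [j l|l|l].
- have := Ck_coord j l (open_Edom oc) (Ck_gTheta_mx 1 oc).
  by case=> + _; exact.
- rewrite (_ : (fun y => _) = fun y => gT i y W (coordv l)); last first.
    by rewrite funeqE => y; rewrite gTheta_mx_contract1.
  apply: derive_line_cst => h.
  by rewrite -[h *: W + _]/(h *: W + (row_mx x 0 + tau *: W)) addrCA -scalerDl !gTheta_ray.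
- rewrite (_ : (fun y => _) = fun y => gT i y W W); last first.
    by rewrite funeqE => y; rewrite gTheta_mx_contract2.
  exact: derive_gTheta_ray.
Qed.

Lemma riem_exp_fiber : open (chart i) -> chart i x ->
  riem_exp (gTheta_mx g a s t nu i) (Edom i) (row_mx x 0) W = row_mx x w.
Proof.
move=> oc cx; rewrite (riem_exp_line (open_Edom oc)) /W ?add_row_mx ?add0r ?addr0 //.
- by move=> m; exact: Ck_gTheta_mx.
- by move=> p Ep; exact: gTheta_mx_unit.
- by move=> tau; rewrite -/(ray tau) rayE /Edom /= row_mxKl.
- by move=> tau k; exact: christoffel_ray.
Qed.

End Ray.

End FiberGeodesics.

(** * Convergence of the instantons *)

Section ProductProjections.
Context {R : realType} {V : normedModType R}.

Lemma differentiable_fst (z : R * V) : differentiable (fun z : R * V => z.1) z.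
Proof. by apply: (linear_differentiable (f := fst)) => y; exact: cvg_fst. Qed.

Lemma differentiable_snd (z : R * V) : differentiable (fun z : R * V => z.2) z.
Proof. by apply: (linear_differentiable (f := snd)) => y; exact: cvg_snd. Qed.

Lemma Ck_fst n (U : set (R * V)) : Ck n U (fun z : R * V => z.1).
Proof. by apply: Ck_linear => // x; exact: differentiable_fst. Qed.

Lemma Ck_snd n (U : set (R * V)) : Ck n U (fun z : R * V => z.2).
Proof. by apply: Ck_linear => // x; exact: differentiable_snd. Qed.

Lemma Ck_comp_snd (W : normedModType R) n (U : set (R * V)) (U' : set V) (f : V -> W) :
  (forall z, U z -> U' z.2) -> Ck n U' f -> Ck n U (fun z : R * V => f z.2).
Proof.
move=> UU'; apply: (Ck_comp_affine (L := fun z : R * V => z.2) (l := fun z : R * V => z.2)) => //.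
exact: differentiable_snd.
Qed.

End ProductProjections.

Section UnitBall.
Context {R : realType}.

Lemma continuous_dotv m : continuous (fun u : 'rV[R]_m => dotv u u).
Proof. by move=> u; apply: differentiable_continuous; exact: differentiable_dotv. Qed.

Lemma B1E : @B1 R = [set u | dotv u u < 1].
Proof.
apply/seteqP; split => u; rewrite /B1 /= -enorm_sqr => u1.
  by rewrite expr_lt1 // sqrtr_ge0.
by rewrite -(@expr_lt1 _ 2) // sqrtr_ge0.
Qed.

Lemma open_B1 : open (@B1 R).
Proof.
rewrite B1E; apply: (open_comp (f := fun u : 'rV[R]_4 => dotv u u) (D := [set x | x < 1])).
  by move=> u _; exact: continuous_dotv.
exact: open_lt.
Qed.

(** Row vectors carry the sup norm, so the Euclidean ball has to be shown bounded and closed for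
    it. *)
Lemma compact_dotv_le1 m : compact [set u : 'rV[R]_m | dotv u u <= 1].
Proof.
apply: bounded_closed_compact.
  exists 1; split; first exact: num_real.
  move=> M M1 u /= u1; rewrite [leLHS]/Num.norm /= mx_normrE.
  apply: bigmax_le => [|[i j] _ /=]; first by rewrite ltW // (lt_trans ltr01).
  rewrite (ord1 i) (le_trans _ (ltW M1)) // -(@expr_le1 _ 2) //.
  rewrite -normrX ger0_norm ?sqr_ge0 // (le_trans _ u1) //.
  by rewrite /dotv (bigD1 j) //= -expr2 lerDl sumr_ge0 // => k _; rewrite -expr2 sqr_ge0.
apply: (closed_comp (f := fun u : 'rV[R]_m => dotv u u) (D := [set x | x <= 1])).
  by move=> u _; exact: continuous_dotv.
exact: closed_le.
Qed.

End UnitBall.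

(** * Convergence off the zero section *)

Section Instantons.
Context {R : realType} (Z : orbifold (R := R)).
Context (g : local_metrics Z) (a : local_connections Z) (s : R)
        (t nu theta N iota chi : R -> R).
Hypothesis q : profile_quotients t nu theta N iota chi.
Implicit Types (i : cidx Z) (p xi : 'rV[R]_(4 + 4)).

Lemma A_instE (y0 : R) i p xi : 0 < y0 -> rsubmx p != 0 ->
  A_inst a t y0 i p xi =
  (theta (Defs.radius p) ^+ 2 /
    (y0^-1 + dotv (rsubmx p) (rsubmx p) * iota (Defs.radius p))) *:
  qim (qmul (qconj (rsubmx p)) (vert a i p xi)).
Proof.
move=> y0_gt0 v0; rewrite /A_inst etaE scalerA; congr (_ *: _).
have r0 : 0 < Defs.radius p by rewrite lt_neqAle sqrtr_ge0 eq_sym enorm_eq0 v0.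
have rE : dotv (rsubmx p) (rsubmx p) = Defs.radius p ^+ 2 by rewrite enorm_sqr.
have J := int0_iota q (ltW r0).
have iP := iota_gt0 q (Defs.radius p).
rewrite rE -[2 * y0 * _]mulrA (mulrCA 2) J (t_theta q (ltW r0)).
move: r0 iP; set r := Defs.radius p; move: (theta r) (iota r) => th io r0 io0.
have d1 : 1 + y0 * (r ^+ 2 * io) != 0.
  by rewrite gt_eqF // addr_gt0 // !mulr_gt0 // exprn_gt0.
have d2 : y0^-1 + r ^+ 2 * io != 0.
  by rewrite gt_eqF // addr_gt0 ?invr_gt0 // mulr_gt0 // exprn_gt0.
have y0_neq0 : y0 != 0 by rewrite gt_eqF.
have r_neq0 : r != 0 by rewrite gt_eqF.
have -> : y0^-1 + r ^+ 2 * io = (1 + y0 * (r ^+ 2 * io)) / y0.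
  by rewrite mulrDl mul1r [y0 * _]mulrC mulfK.
by field; rewrite d1 y0_neq0.
Qed.

Lemma A_limE i p xi : rsubmx p != 0 ->
  A_lim a t i p xi =
  (theta (Defs.radius p) ^+ 2 /
    (dotv (rsubmx p) (rsubmx p) * iota (Defs.radius p))) *:
  qim (qmul (qconj (rsubmx p)) (vert a i p xi)).
Proof.
move=> v0; rewrite /A_lim etaE scalerA; congr (_ *: _).
have r0 : 0 < Defs.radius p by rewrite lt_neqAle sqrtr_ge0 eq_sym enorm_eq0 v0.
have rE : dotv (rsubmx p) (rsubmx p) = Defs.radius p ^+ 2 by rewrite enorm_sqr.
rewrite rE (int0_iota q (ltW r0)) (t_theta q (ltW r0)).
have := iota_gt0 q (Defs.radius p).
move: r0; set r := Defs.radius p; move: (theta r) (iota r) => th io r0 io0.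
have io_neq0 : io != 0 by rewrite gt_eqF.
have r_neq0 : r != 0 by rewrite gt_eqF.
by field; rewrite io_neq0.
Qed.

(* With mu = 1 / y0 the instantons form a smooth family that reaches A_lim at
   mu = 0. *)
Lemma cvg_A_inst (y : nat -> R) i (K : set 'rV[R]_(4 + 4)) :
  open (chart i) -> smooth_on (chart i) (a i) ->
  (forall n, 0 < y n) -> (y n)^-1 @[n --> \oo] --> 0 ->
  compact K -> K `<=` Edom_punctured i ->
  cvg_form (Edom_punctured i) K (fun n => A_inst a t (y n) i) (A_lim a t i).
Proof.
move=> oc Ca y_gt0 y0 cK KE xi.
pose J p := dotv (rsubmx p) (rsubmx p) * iota (Defs.radius p).
(* Asking for a positive denominator, rather than [mu >= 0], gives an open set that contains the
   slice [mu = 0] off the zero section. *)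
pose Om := [set z : R * 'rV[R]_(4 + 4) | Edom i z.2 /\ 0 < z.1 + J z.2].
pose F (z : R * 'rV[R]_(4 + 4)) := (theta (Defs.radius z.2) ^+ 2 / (z.1 + J z.2)) *:
  qim (qmul (qconj (rsubmx z.2)) (vert a i z.2 xi)).
have oT := @openT 'rV[R]_(4 + 4).
have oTT := @openT (R * 'rV[R]_(4 + 4))%type.
have CJ n : Ck n setT J.
  apply: Ck_mul => //.
    by apply: Ck_dotv => //; exact: Ck_rsubmx.
  by apply: Ck_radius => //; [exact: iota_smooth q|exact: iota_even q].
have CD n : Ck n setT (fun z : R * 'rV[R]_(4 + 4) => z.1 + J z.2).
  apply: Ck_add => //; first exact: Ck_fst.
  exact: (Ck_comp_snd (U' := setT)).
have oOm : open Om.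
  rewrite (_ : Om = (fun z : R * 'rV[R]_(4 + 4) => z.2) @^-1` Edom i `&`
    (fun z => z.1 + J z.2) @^-1` [set x | 0 < x]) //.
  apply: openI; apply: open_comp.
  - by move=> z _; exact: cvg_snd.
  - exact: open_Edom.
  - by move=> z _; exact: (Ck_continuous_at (CD 1%N)).
  - exact: open_gt.
have CF n : Ck n Om F.
  apply: Ck_scale => //.
    apply: Ck_mul => //.
      apply: (Ck_comp_snd (U' := setT) (f := fun p => theta (Defs.radius p) ^+ 2)) => //.
      apply: Ck_exp => //.
      by apply: Ck_radius => //; [exact: theta_smooth q|exact: theta_even q].
    apply: Ck_inv => // [z [_ z0]|]; first by rewrite gt_eqF.
    exact: Ck_sub (CD n).
  apply: (Ck_comp_snd (U' := Edom i)
    (f := fun p => qim (qmul (qconj (rsubmx p)) (vert a i p xi)))) => [z []//|].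
  have oE := open_Edom oc.
  apply: Ck_qim => //; apply: Ck_qmul => //; last exact: Ck_vert.
  by apply: Ck_qconj => //; exact: Ck_rsubmx.
have J_gt0 p : Edom_punctured i p -> 0 < J p.
  move=> [_ v0]; rewrite mulr_gt0 ?(iota_gt0 q) //.
  by rewrite lt_neqAle dotv_ge0 eq_sym dotv_eq0 v0.
have OmE mu p : 0 <= mu -> Edom_punctured i p -> Om (mu, p).
  by move=> mu0 Ep; split; [case: Ep|rewrite ltr_wpDl // J_gt0].
apply: (cvg_smooth_slice oOm (open_Edom_punctured oc) cK KE _ CF (mu := fun n => (y n)^-1)) => //.
- by move=> p /KE; exact: OmE.
- by move=> p; exact: OmE.
- by move=> n p; apply: OmE; rewrite invr_ge0 ltW.
- by move=> n p [_ v0]; rewrite A_instE.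
- by move=> p [_ v0]; rewrite A_limE // /F /= add0r.
Qed.

End Instantons.

(** * Bubbling along the zero section *)

Section Bubble.
Context {R : realType} (Z : orbifold (R := R)).
Context (g : local_metrics Z) (a : local_connections Z) (s : R)
        (t nu theta N iota chi : R -> R).
Hypothesis q : profile_quotients t nu theta N iota chi.
Hypotheses (s_gt0 : 0 < s) (gmetric : riemannian_metric g).
Hypothesis a_smooth : forall i, smooth_on (chart i) (a i).
Variables (i : cidx Z) (x h : 'rV[R]_4).
Hypotheses (oc : open (chart i)) (cx : chart i x) (h1 : SU2 h).

Lemma s_mapE lam u : s_map g a s t nu i x h lam u = row_mx x (lam *: qmul h u).
Proof. exact: (riem_exp_fiber q s_gt0 gmetric a_smooth _ oc cx). Qed.

Let dotv_h : dotv h h = 1.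
Proof. by rewrite -enorm_sqr (h1 : enorm h = 1) expr1n. Qed.

(** The pulled back directions are vertical, so the local connection [a] drops out. The factor
    [lam ^ 2] from the product of [qconj v] and [dv] joins [y0] to form [kappa], and [|h| = 1]
    removes the frame. *)
Lemma pullback_A_inst (kappa lam y0 : R) u w : 0 < kappa -> 0 < lam -> 0 < y0 ->
  y0 * lam ^+ 2 = kappa ->
  pullback (s_map g a s t nu i x h lam) (A_inst a t y0 i) u w =
  (kappa * theta (Num.sqrt (lam ^+ 2 * dotv u u)) ^+ 2 /
    (1 + kappa * (dotv u u * iota (Num.sqrt (lam ^+ 2 * dotv u u))))) *:
  qim (qmul (qconj u) w).
Proof.
move=> kappa_gt0 lam_gt0 y0_gt0 E; rewrite /pullback.
have -> : 'D_w (s_map g a s t nu i x h lam) u = row_mx 0 (lam *: qmul h w).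
  apply: derive_line_affine => k; rewrite !s_mapE scale_row_mx add_row_mx scaler0 add0r.
  by rewrite qmul_linear scalerDr !scalerA mulrC.
rewrite s_mapE; set p := row_mx x _.
have rp : rsubmx p = lam *: qmul h u by rewrite row_mxKr.
have dp : dotv (rsubmx p) (rsubmx p) = lam ^+ 2 * dotv u u.
  by rewrite rp dotvZl dotvZr dotv_mul dotv_h mul1r mulrA expr2.
have vp : vert a i p (row_mx 0 (lam *: qmul h w)) = lam *: qmul h w.
  by rewrite vert_vertical ?row_mxKr // row_mxKl.
have im : qim (qmul (qconj (rsubmx p)) (lam *: qmul h w)) =
    lam ^+ 2 *: qim (qmul (qconj u) w).
  rewrite rp im_conj_scale -[lam *: qmul h w]addr0 im_conj_mul_add im_conj_mul dotv_h scale1r.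
  have := im_conj_mul_add (qmul h u) (-1) 0 0.
  rewrite scaler0 addr0 scaleN1r addNr => ->.
  by rewrite addr0 scalerA expr2.
have rE : Defs.radius p = Num.sqrt (lam ^+ 2 * dotv u u) by rewrite -dp.
(* [A_instE] excludes the zero section; at the center both sides vanish through [qconj 0]. *)
have [u0|u0] := eqVneq u 0.
  rewrite /A_inst etaE vp im u0.
  have -> : qim (qmul (qconj 0) w) = 0.
    by rewrite -[X in qconj X](scale0r (0 : 'rV[R]_4)) im_conj_scale scale0r.
  by rewrite !scaler0.
have du : 0 < dotv u u by rewrite lt_neqAle dotv_ge0 eq_sym dotv_eq0 u0.
rewrite (A_instE _ q) ?vp ?im //; last first.
  by rewrite -dotv_eq0 dp mulf_neq0 ?gt_eqF // exprn_gt0.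
rewrite dp rE scalerA; congr (_ *: _); rewrite -E.
have := iota_gt0 q (Num.sqrt (lam ^+ 2 * dotv u u)).
move: (theta _) (iota _) => th io io0; move: du; set d := dotv u u => d0.
have d1 : 1 + y0 * lam ^+ 2 * (d * io) != 0.
  by rewrite gt_eqF // addr_gt0 // E !mulr_gt0.
have y0_neq0 : y0 != 0 by rewrite gt_eqF.
have -> : y0^-1 + lam ^+ 2 * d * io = (1 + y0 * lam ^+ 2 * (d * io)) / y0.
  by field.
by field; rewrite d1.
Qed.

Lemma A_asdE (kappa : R) u w : 0 < kappa ->
  A_asd kappa u w = (kappa / (1 + kappa * dotv u u)) *: qim (qmul (qconj u) w).
Proof.
move=> kappa_gt0; rewrite /A_asd maurer_cartanE enorm_sqr.
have [->|u0] := eqVneq u 0.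
  have -> : qim (qmul (qconj 0) w) = 0.
    by rewrite -[X in qconj X](scale0r (0 : 'rV[R]_4)) im_conj_scale scale0r.
  by rewrite !scaler0.
have du : 0 < dotv u u by rewrite lt_neqAle dotv_ge0 eq_sym dotv_eq0 u0.
rewrite scalerA; congr (_ *: _); move: du; set d := dotv u u => d0.
have d1 : 1 + kappa * d != 0 by rewrite gt_eqF // addr_gt0 // mulr_gt0.
have d_neq0 : d != 0 by rewrite gt_eqF.
by field; rewrite d1.
Qed.

(* After rescaling by lam = sqrt (kappa / y0) the pulled back connections
   depend on y0 only through lam, smoothly up to lam = 0. *)
Lemma cvg_bubble (kappa : R) (lam y : nat -> R) : 0 < kappa ->
  (forall n, 0 < lam n) -> (forall n, 0 < y n) ->
  (forall n, y n * lam n ^+ 2 = kappa) -> lam n @[n --> \oo] --> 0 ->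
  cvg_form B1 B1
    (fun n => pullback (s_map g a s t nu i x h (lam n)) (A_inst a t (y n) i))
    (A_asd kappa).
Proof.
move=> kappa_gt0 lam_gt0 y_gt0 E lam0 w.
(* The squared radius of the rescaled point is polynomial in [(lam, u)]. With it [Ck_radial] gives
   smoothness jointly in both variables, on an open set that includes [lam <= 0]. *)
pose P (z : R * 'rV[R]_4) := z.1 ^+ 2 * dotv z.2 z.2.
pose D (z : R * 'rV[R]_4) := 1 + kappa * (dotv z.2 z.2 * iota (Num.sqrt (P z))).
pose F (z : R * 'rV[R]_4) := (kappa * theta (Num.sqrt (P z)) ^+ 2 / D z) *:
  qim (qmul (qconj z.2) w).
have oT := @openT (R * 'rV[R]_4)%type.
have Cdot n : Ck n setT (fun z : R * 'rV[R]_4 => dotv z.2 z.2).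
  by apply: Ck_dotv => //; exact: Ck_snd.
have CP n : Ck n setT P.
  by apply: Ck_mul => //; apply: Ck_exp => //; exact: Ck_fst.
have P_ge0 z : 0 <= P z by rewrite mulr_ge0 ?sqr_ge0 ?dotv_ge0.
have CD n : Ck n setT D.
  apply: Ck_add => //; first exact: Ck_cst.
  apply: Ck_mul => //; first exact: Ck_cst.
  apply: Ck_mul => //; apply: Ck_radial => //; [exact: iota_smooth q|exact: iota_even q].
have D_gt0 z : 0 < D z.
  apply: ltr_wpDr => //; apply: mulr_ge0; first exact: ltW.
  by apply: mulr_ge0; [exact: dotv_ge0|apply: ltW; exact: iota_gt0 q _].
have CF n : Ck n setT F.
  apply: Ck_scale => //.
    apply: Ck_mul => //; last by apply: Ck_inv => // z _; rewrite gt_eqF.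
    apply: Ck_mul => //; first exact: Ck_cst.
    apply: Ck_exp => //; apply: Ck_radial => //; [exact: theta_smooth q|exact: theta_even q].
  apply: Ck_qim => //; apply: Ck_qmul => //; last exact: Ck_cst.
  by apply: Ck_qconj => //; exact: Ck_snd.
(* The open ball is not compact, so uniformity is taken from the closed ball around it. *)
apply: (cvg_smooth_slice oT open_B1 (compact_dotv_le1 (m := 4)) _ _ CF (mu := lam)) => //.
- by rewrite B1E => u /= /ltW.
- by move=> n u _; rewrite (pullback_A_inst _ _ kappa_gt0 _ _ (E n)).
- move=> u _; rewrite A_asdE // /F /D /P /= expr0n mul0r sqrtr0.
  by rewrite (theta_0 q) (iota_0 q) expr1n !mulr1.
Qed.

End Bubble.

Theorem theorem13 (R : realType) (Z : orbifold (R := R))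
    (g : local_metrics Z) (s : R) (X : spin_bundle g)
    (a : local_connections Z) (nu0 : R) (t nu : R -> R) (y : nat -> R)
    (Zcompact : compact [set: carrier Z])
    (Zoriented : oriented Z)
    (gmetric : riemannian_metric g)
    (geinstein : einstein g)
    (gscal : scalar_curvature g s) (s_gt0 : 0 < s)
    (gasd : asd_weyl g)
    (aLC : levi_civita X a)
    (nu0_gt0 : 0 < nu0) (tnu : profile nu0 t nu)
    (y_gt0 : forall n, 0 < y n)
    (y_ndecr : {homo y : m n / (m <= n)%N >-> m <= n})
    (y_oo : y n @[n --> \oo] --> +oo) :
  (forall kappa : R, 0 < kappa ->
     exists lam : R -> R,
       [/\ forall y0 : R, 0 < y0 -> 0 < lam y0,
           lam (y n) @[n --> \oo] --> 0
         & forall (z : carrier Z) (i : cidx Z) (x h : 'rV[R]_4),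
             chart i x -> chart_map i x = z -> SU2 h ->
             cvg_form B1 B1
               (fun n => pullback (s_map g a s t nu i x h (lam (y n)))
                                  (A_inst a t (y n) i))
               (A_asd kappa)])
  /\
  (forall (i : cidx Z) (K : set 'rV[R]_(4 + 4)),
     compact K -> K `<=` Edom_punctured i ->
     cvg_form (Edom_punctured i) K (fun n => A_inst a t (y n) i)
              (A_lim a t i)).
Proof.
have [theta [N [iota [chi q]]]] := profile_quotientsP nu0_gt0 tnu.
have [a_smooth _] := aLC.
have oc (i : cidx Z) : open (chart i) by exact: chart_open (orb_axioms Z) i.
have y0 : (y n)^-1 @[n --> \oo] --> 0.
  by apply/gtr0_cvgV0 => //; near=> n; exact: y_gt0.
split=> [kappa kappa_gt0|i K cK KE]; last exact: (cvg_A_inst q).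
exists (fun y0 => Num.sqrt (kappa / y0)); split.
- by move=> y1 y1_gt0; rewrite sqrtr_gt0 divr_gt0.
- have c0 : kappa / y n @[n --> \oo] --> 0.
    by rewrite -(mulr0 kappa); apply: cvgM => //; exact: cvg_cst.
  rewrite -(sqrtr0 R).
  exact: (cvg_comp _ _ c0 (@sqrt_continuous R 0)).
- move=> z i x h cx _ h1; apply: (cvg_bubble q) => //.
  + by move=> n; rewrite sqrtr_gt0 divr_gt0.
  + by move=> n; rewrite sqr_sqrtr ?divr_ge0 ?ltW // mulrCA mulfV ?mulr1 // gt_eqF.
  + have c0 : kappa / y n @[n --> \oo] --> 0.
      by rewrite -(mulr0 kappa); apply: cvgM => //; exact: cvg_cst.
    rewrite -(sqrtr0 R).
    exact: (cvg_comp _ _ c0 (@sqrt_continuous R 0)).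
Unshelve. all: by end_near. Qed.
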